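(* Let $(\mathcal{E},\mathcal{D}(\mathcal{E}))$ be a regular, irreducible, transient Dirichlet form on $L^2(E;m)$, and let $\mu$ be a positive smooth Radon measure on $E$ such that the form $\mathcal{E}^\mu(u,v)=\mathcal{E}(u,v)-\int_Euv\,d\mu$ on $\mathcal{D}(\mathcal{E})\cap C_0(E)$ is positive semi-definite and closable in $L^2(E;m)$, with closure $(\mathcal{E}^\mu,\mathcal{D}(\mathcal{E}^\mu))$. Suppose $(\mathcal{E}^\mu,\mathcal{D}(\mathcal{E}^\mu))$ is subcritical, and let $g\in L^1(E;m)$ be bounded, strictly positive $m$-a.e., with $\int_E|u|g\,dm\le\sqrt{\mathcal{E}^\mu(u)}$ for all $u\in\mathcal{D}_e(\mathcal{E}^\mu)$. Then $G^\mu g=\int_0^\infty T^\mu_tg\,dt$ belongs to $\mathcal{H}^+(\mu)$, and the Dirichlet form $(\mathcal{E}^{\mu,G^\mu g},\mathcal{D}(\mathcal{E}^{\mu,G^\mu g}))$ is transient.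
   Context: $E$ is a locally compact separable metric space, $m$ a positive Radon measure on $E$ with full topological support, $C_0(E)$ the continuous functions with compact support; $a(u)=a(u,u)$. Irreducible: if a measurable $A\subset E$ satisfies $T_t(1_Af)=1_AT_tf$ $m$-a.e. for all $f\in L^2(E;m)$, $t>0$ ($T_t$ the semigroup of $\mathcal{E}$), then $m(A)=0$ or $m(A^c)=0$. A Dirichlet form $(\mathcal{A},\mathcal{D}(\mathcal{A}))$ on $L^2(E;n)$ is transient if there is a bounded $g_0\in L^1(E;n)$, $g_0>0$ a.e., with $\int_E|u|g_0\,dn\le\sqrt{\mathcal{A}(u)}$ for all $u\in\mathcal{D}(\mathcal{A})$. A positive Borel measure is smooth if it charges no set of zero capacity and there are increasing closed sets $F_n$ with $\mu(F_n)<\infty$ and $\lim_n\mathrm{Cap}(K\setminus F_n)=0$ for every compact $K$ (Cap is the 1-capacity of $\mathcal{E}$). $\mathcal{D}_e(\mathcal{E}^\mu)$ (extended Schrödinger space) is the set of $m$-measurable $u$ with $|u|<\infty$ $m$-a.e. for which there is an $\mathcal{E}^\mu$-Cauchy sequence $u_n\in\mathcal{D}(\mathcal{E}^\mu)$ with $u_n\to u$ $m$-a.e.; $\mathcal{E}^\mu(u)=\lim_n\mathcal{E}^\mu(u_n)$. Subcritical means that a function $g$ as in the claim exists. $\{T^\mu_t\}$ is the $L^2(E;m)$-semigroup of $(\mathcal{E}^\mu,\mathcal{D}(\mathcal{E}^\mu))$; it is positivity preserving and is extended to non-negative measurable functions by monotone limits. $\mathcal{H}^+(\mu)=\{h:0<h<\infty\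 m\text{-a.e.},\ T^\mu_th\le h\ m\text{-a.e. for all }t>0\}$. For $h\in\mathcal{H}^+(\mu)$, $(\mathcal{E}^{\mu,h},\mathcal{D}(\mathcal{E}^{\mu,h}))$ is the Dirichlet form on $L^2(E;h^2m)$ given by $\mathcal{E}^{\mu,h}(u,v)=\mathcal{E}^\mu(hu,hv)$, $\mathcal{D}(\mathcal{E}^{\mu,h})=\{u\in L^2(E;h^2m):hu\in\mathcal{D}(\mathcal{E}^\mu)\}$. *)

(* Defs.v *)
From HB Require Import structures.
From mathcomp Require Import all_boot all_order all_algebra.
From mathcomp Require Import all_classical all_reals all_analysis.
From mathcomp Require Import measurable_realfun.

Set Implicit Arguments.
Unset Strict Implicit.
Unset Printing Implicit Defensive.
Import Order.TTheory GRing.Theory Num.Theory.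
Import numFieldNormedType.Exports.

Local Open Scope classical_set_scope.
Local Open Scope ring_scope.

(* A metric space equipped with its Borel sigma-algebra. *)
HB.mixin Record isBorelMetric (d : measure_display) (R : numDomainType) T
    & Measurable d T & Metric R T := {
  measurable_borel : @measurable d T = <<s @open T >>
}.

#[short(type="borelMetricType")]
HB.structure Definition BorelMetric (d : measure_display) (R : numDomainType) :=
  { T of Measurable d T & Metric R T & isBorelMetric d R T }.

Definition separable_space (T : topologicalType) :=
  exists2 A : set T, countable A & dense A.

Section Measures.
Context {d : measure_display} {R : realType} {E : borelMetricType d R}.
Implicit Types m : {measure set E -> \bar R}.

(* On a locally compact separable metric space, Borel measures finite on
   compact sets are automatically regular. *)
Definition radon_measure m := forall K : set E, compact K -> (m K < +oo)%E.

Definition full_support m :=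
  forall U : set E, open U -> U !=set0 -> (0 < m U)%E.

Definition C0 : set (E -> R) :=
  [set u | continuous u /\ compact (closure [set x | u x != 0])].

(* Elements of L^2(E; m) are represented by Borel functions; all the notions
   below are invariant under m-a.e. modification of the representatives. *)
Definition inner m (u v : E -> R) : R := \int[m]_x (u x * v x).

Definition L2sq m (u : E -> R) : R := inner m u u.

End Measures.

Section Forms.
Context {d : measure_display} {R : realType} {E : borelMetricType d R}.
Implicit Types m mu : {measure set E -> \bar R}.

(* The values of [fval] outside [dom] are irrelevant. *)
Record qform := QForm {
  dom : set (E -> R) ;
  fval :> (E -> R) -> (E -> R) -> R
}.
Implicit Types F : qform.
Implicit Types T : R -> (E -> R) -> (E -> R).

Definition energy1 m F (u : E -> R) : R := F u u + L2sq m u.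

Definition cauchy_for (N : (E -> R) -> R) (u_ : nat -> E -> R) :=
  forall e : R, 0 < e -> exists n0 : nat, forall n k : nat,
    (n0 <= n)%N -> (n0 <= k)%N -> N (u_ n - u_ k) < e.

Record symmetric_form m F : Prop := {
  sf_L2 : forall u, dom F u -> u \in Lfun m 2%:E ;
  sf_ae_dom : forall u v, dom F u -> measurable_fun setT v ->
    u = v %[ae m] -> dom F v ;
  sf_ae_val : forall u v w, dom F u -> dom F v -> dom F w ->
    u = v %[ae m] -> F u w = F v w ;
  sf_dom0 : dom F 0 ;
  sf_dom_lin : forall (a : R) u v, dom F u -> dom F v -> dom F (a *: u + v) ;
  sf_lin : forall (a : R) u v w, dom F u -> dom F v -> dom F w ->
    F (a *: u + v) w = a * F u w + F v w ;
  sf_sym : forall u v, dom F u -> dom F v -> F u v = F v u ;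
  sf_ge0 : forall u, dom F u -> 0 <= F u u ;
  sf_dense : forall f, f \in Lfun m 2%:E -> forall e : R, 0 < e ->
    exists2 u, dom F u & L2sq m (f - u) < e
}.

Definition closed_form m F :=
  forall u_ : nat -> E -> R, (forall n, dom F (u_ n)) ->
    cauchy_for (energy1 m F) u_ ->
    exists2 u, dom F u & energy1 m F (u_ n - u) @[n --> \oo] --> (0 : R).

Definition unit_contraction (u : E -> R) : E -> R :=
  fun x => Num.min (Num.max (u x) 0) 1.

Definition markovian F := forall u, dom F u ->
  dom F (unit_contraction u) /\
  F (unit_contraction u) (unit_contraction u) <= F u u.

Definition dirichlet_form m F :=
  [/\ symmetric_form m F, closed_form m F & markovian F].

Definition regular_form m F :=
  (forall u, dom F u -> forall e : R, 0 < e ->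
    exists2 v, (dom F `&` C0) v & energy1 m F (u - v) < e) /\
  (forall f, C0 f -> forall e : R, 0 < e ->
    exists2 v, (dom F `&` C0) v & forall x, `|f x - v x| < e).

(* Bounded elements of L^1(E; m) that are strictly positive m-a.e. *)
Definition weight m (g : E -> R) :=
  [/\ m.-integrable setT (EFin \o g),
      (exists C : R, forall x, `|g x| <= C) &
      \forall x \ae m, 0 < g x].

Definition transient m F := exists2 g0, weight m g0 &
  forall u, dom F u ->
    (\int[m]_x (`|u x| * g0 x)%:E <= (Num.sqrt (F u u))%:E)%E.

(* Strongly continuous contraction semigroups of symmetric operators on
   L^2(E; m), indexed by t > 0. *)
Record symmetric_semigroup m T : Prop := {
  sg_L2 : forall (t : R) u, 0 < t -> u \in Lfun m 2%:E -> T t u \in Lfun m 2%:E ;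
  sg_ae : forall (t : R) u v, 0 < t -> u \in Lfun m 2%:E -> v \in Lfun m 2%:E ->
    u = v %[ae m] -> T t u = T t v %[ae m] ;
  sg_lin : forall (t a : R) u v, 0 < t ->
    u \in Lfun m 2%:E -> v \in Lfun m 2%:E ->
    T t (a *: u + v) = a *: T t u + T t v %[ae m] ;
  sg_sym : forall (t : R) u v, 0 < t -> u \in Lfun m 2%:E -> v \in Lfun m 2%:E ->
    inner m (T t u) v = inner m u (T t v) ;
  sg_contract : forall (t : R) u, 0 < t -> u \in Lfun m 2%:E ->
    L2sq m (T t u) <= L2sq m u ;
  sg_add : forall (s t : R) u, 0 < s -> 0 < t -> u \in Lfun m 2%:E ->
    T (s + t) u = T s (T t u) %[ae m] ;
  sg_cont : forall u, u \in Lfun m 2%:E ->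
    L2sq m (T t u - u) @[t --> 0^'+] --> (0 : R)
}.

(* T is the semigroup of the closed form F: its infinitesimal generator A is
   the operator associated with F, i.e. A u = - f if and only if u is in the
   domain of F and F(u, v) = (f, v) for all v in the domain of F. *)
Definition semigroup_of m F T :=
  symmetric_semigroup m T /\
  forall u f, u \in Lfun m 2%:E -> f \in Lfun m 2%:E ->
    (L2sq m (t^-1 *: (T t u - u) + f) @[t --> 0^'+] --> (0 : R)) <->
    (dom F u /\ forall v, dom F v -> F u v = inner m f v).

Definition irreducible m F := forall T, semigroup_of m F T ->
  forall A : set E, measurable A ->
    (forall (t : R) f, 0 < t -> f \in Lfun m 2%:E ->
      T t (\1_A * f) = \1_A * T t f %[ae m]) ->
    m A = 0%E \/ m (~` A) = 0%E.

Definition cap_open m F (O : set E) : \bar R :=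
  ereal_inf [set (energy1 m F u)%:E | u in
    [set u | dom F u /\ \forall x \ae m, O x -> 1 <= u x]].

Definition capacity m F (A : set E) : \bar R :=
  ereal_inf [set cap_open m F O | O in [set O | open O /\ A `<=` O]].

Definition smooth_measure m F mu :=
  (forall A : set E, measurable A -> capacity m F A = 0%E -> mu A = 0%E) /\
  exists K_ : nat -> set E,
    [/\ (forall n, closed (K_ n)),
        (forall n, K_ n `<=` K_ n.+1),
        (forall n, (mu (K_ n) < +oo)%E) &
        forall K : set E, compact K ->
          capacity m F (K `\` K_ n) @[n --> \oo] --> 0%E].

Definition schroedinger_form F mu : qform :=
  QForm (dom F `&` C0) (fun u v => F u v - \int[mu]_x (u x * v x)).

Definition positive_semidefinite F := forall u, dom F u -> 0 <= F u u.

Definition closable m F :=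
  forall u_ : nat -> E -> R, (forall n, dom F (u_ n)) ->
    cauchy_for (fun u => F u u) u_ ->
    L2sq m (u_ n) @[n --> \oo] --> (0 : R) ->
    F (u_ n) (u_ n) @[n --> \oo] --> (0 : R).

(* F is the closure of F0: the closed form extending F0 in whose domain that
   of F0 is dense. *)
Definition closure_of m (F0 F : qform) :=
  [/\ symmetric_form m F, closed_form m F,
      dom F0 `<=` dom F,
      (forall u v, dom F0 u -> dom F0 v -> F u v = F0 u v) &
      forall u, dom F u -> forall e : R, 0 < e ->
        exists2 v, dom F0 v & energy1 m F (u - v) < e].

(* u is in the extended space of F, with F(u) = c. *)
Definition extended_value m F (u : E -> \bar R) (c : R) :=
  [/\ measurable_fun setT u, (\forall x \ae m, (`|u x| < +oo)%E) &
      exists u_ : nat -> E -> R,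
        [/\ (forall n, dom F (u_ n)),
            cauchy_for (fun v => F v v) u_,
            (\forall x \ae m, (u_ n x)%:E @[n --> \oo] --> u x) &
            F (u_ n) (u_ n) @[n --> \oo] --> c]].

Definition subcritical_weight m F (g : E -> R) := weight m g /\
  forall u c, extended_value m F u c ->
    (\int[m]_x (`|u x| * (g x)%:E) <= (Num.sqrt c)%:E)%E.

Definition subcritical m F := exists g, subcritical_weight m F g.

Definition L2_approx m (h : E -> \bar R) : set (nat -> E -> R) :=
  [set f_ | [/\ (forall n, f_ n \in Lfun m 2%:E),
      (forall n, \forall x \ae m, 0 <= f_ n x) &
      \forall x \ae m, nondecreasing_seq (f_ ^~ x) /\
        (f_ n x)%:E @[n --> \oo] --> h x]].

(* Extension of a positivity preserving semigroup to nonnegative measurable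
   functions; up to a null set, it does not depend on the chosen sequence. *)
Definition semigroup_ext m T (t : R) (h : E -> \bar R) : E -> \bar R :=
  let f_ := xget (fun=> 0) (L2_approx m h) in
  fun x => limn (fun n => (T t (f_ n) x)%:E).

Definition Hplus m T : set (E -> \bar R) :=
  [set h | [/\ measurable_fun setT h,
      (\forall x \ae m, (0 < h x < +oo)%E) &
      forall t : R, 0 < t -> \forall x \ae m, (semigroup_ext m T t h x <= h x)%E]].

(* G is (an m-version of) \int_0^oo T_t g dt, the integral being that of a
   jointly measurable version p of (t, x) |-> T_t g x. *)
Definition potential_of m T (g : E -> R) (G : E -> \bar R) :=
  exists p : R -> E -> R,
    [/\ measurable_fun setT (fun z : R * E => p z.1 z.2),
        (forall t : R, 0 < t -> T t g = p t %[ae m]) &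
        \forall x \ae m, G x =
          (\int[lebesgue_measure]_(t in `]0%R, +oo[) (p t x)%:E)%E].

(* The measure h^2 m and the h-transform of F; h is only m-a.e. finite, and
   [fine] changes it to a real function on the null set where it is not. *)
Definition weighted_measure m (h : {mfun E >-> \bar R}) (A : set E) : \bar R :=
  (\int[m]_(x in A) (fine (h x) ^+ 2)%:E)%E.

Section weighted_measure_is_measure.
Variables (m : {measure set E -> \bar R}) (h : {mfun E >-> \bar R}).

Let weighted0 : weighted_measure m h set0 = 0%E.
Proof. exact: integral_set0. Qed.

Let weighted_ge0 A : (0 <= weighted_measure m h A)%E.
Proof. by apply: integral_ge0 => x _; rewrite lee_fin sqr_ge0. Qed.

Let weighted_sigma_additive : semi_sigma_additive (weighted_measure m h).
Proof.
apply: semi_sigma_additive_nng_induced => [|x]; last by rewrite lee_fin sqr_ge0.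
apply/measurable_EFinP/measurable_funX.
exact/measurableT_comp.
Qed.

HB.instance Definition _ := isMeasure.Build d E R (weighted_measure m h)
  weighted0 weighted_ge0 weighted_sigma_additive.

End weighted_measure_is_measure.

Definition h_transform m F (h : {mfun E >-> \bar R}) : qform :=
  let hmul (u : E -> R) : E -> R := fun x => fine (h x) * u x in
  QForm [set u | u \in Lfun (weighted_measure m h) 2%:E /\ dom F (hmul u)]
       (fun u v => F (hmul u) (hmul v)).

End Forms.

Arguments qform {d R} E.

(* Main.v *)
(* Write [T_t], [G_a] for the semigroup and the resolvent of the closed form
   [Fmu], and (.,.) for the inner product of L^2(m).

   The semigroup is positivity preserving: for [f >= 0], [G_a f] minimises
   [Fmu(u) + a (u, u) - 2 (f, u)], and on the core replacing [u] by [|u|] does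
   not increase this functional, because [F] is Markovian and
   [int |u|^2 dmu = int u^2 dmu]; positivity passes from [G_a] to [T_t] by the
   exponential formula.

   For [v = G_a g >= 0], subcriticality gives
   [Fmu(v) <= (g, v) <= sqrt(Fmu(v))], hence [(g, v) <= 1].  Letting [a] tend to
   0, the integral of [t |-> (T_t g, g)] over the half-line is finite, and by
   Tonelli so is [int g Gg dm]; thus [Gg] is finite a.e.  It is positive because
   [T_t g] converges to [g > 0] as [t] tends to 0, and excessive because, for
   [0 <= f <= Gg] and [phi >= 0],
   [(T_t f, phi) <= int Gg T_t phi dm = int_t^oo (T_s g, phi) ds
                 <= int Gg phi dm].

   For the transience of the [h]-transform, [Fmu(h u)] dominates the square of
   [int |h u| g dm], which is the integral of [|u| g / h] with respect to
   [h^2 m]; it remains to lower [g / h] to a bounded [h^2 m]-integrable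
   weight. *)

Require Import Defs.
From HB Require Import structures.
From mathcomp Require Import all_boot all_order all_algebra.
From mathcomp Require Import all_classical all_reals all_analysis.
From mathcomp Require Import measurable_realfun.
From mathcomp Require Import ring lra.
Import Order.TTheory GRing.Theory Num.Theory.
Import numFieldNormedType.Exports.
Local Open Scope classical_set_scope.
Local Open Scope ring_scope.

(** * Positive semidefinite forms *)

(** Stated on a subset of a module, so that one theory serves the inner product of L^2, the forms
    and their shifts. Degeneracy is allowed, since functions are not identified modulo null sets. *)
Record psd_form {R : realType} {V : lmodType R} (D : set V) (b : V -> V -> R)
    : Prop := PsdForm {
  psd_dom0 : D 0 ;
  psd_dom_lin : forall a u v, D u -> D v -> D (a *: u + v) ;
  psd_lin : forall a u v w, D u -> D v -> D w ->
    b (a *: u + v) w = a * b u w + b v w ;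
  psd_sym : forall u v, D u -> D v -> b u v = b v u ;
  psd_ge0 : forall u, D u -> 0 <= b u u }.

Definition seminorm {R : realType} {V : lmodType R} (b : V -> V -> R) (u : V) :=
  Num.sqrt (b u u).

Section PsdFormTheory.
Context {R : realType} {V : lmodType R} {D : set V} {b : V -> V -> R}.
Hypothesis psd : psd_form D b.
Local Notation N := (seminorm b).

Lemma psd_domZ a u : D u -> D (a *: u).
Proof.
move=> Du; rewrite -[_ *: _]addr0; apply: (psd_dom_lin _ _ psd) => //.
exact: (psd_dom0 _ _ psd).
Qed.

Lemma psd_domD u v : D u -> D v -> D (u + v).
Proof. by move=> Du Dv; rewrite -[u]scale1r; exact: (psd_dom_lin _ _ psd). Qed.

Lemma psd_domN u : D u -> D (- u).
Proof. by rewrite -scaleN1r; exact: psd_domZ. Qed.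

Lemma psd_domB u v : D u -> D v -> D (u - v).
Proof. by move=> Du Dv; apply: psd_domD => //; exact: psd_domN. Qed.

Lemma psdDl u v w : D u -> D v -> D w -> b (u + v) w = b u w + b v w.
Proof. by move=> Du Dv Dw; rewrite -[u in LHS]scale1r (psd_lin _ _ psd)// mul1r. Qed.

Lemma psd0l w : D w -> b 0 w = 0.
Proof.
move=> Dw; have D0 := psd_dom0 _ _ psd.
by have := psdDl _ _ _ D0 D0 Dw; rewrite addr0; lra.
Qed.

Lemma psdZl a u w : D u -> D w -> b (a *: u) w = a * b u w.
Proof.
move=> Du Dw; rewrite -[_ *: _]addr0 (psd_lin _ _ psd)//; last exact: (psd_dom0 _ _ psd).
by rewrite psd0l// addr0.
Qed.

Lemma psdNl u w : D u -> D w -> b (- u) w = - b u w.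
Proof. by move=> Du Dw; rewrite -scaleN1r psdZl// mulN1r. Qed.

Lemma psdBl u v w : D u -> D v -> D w -> b (u - v) w = b u w - b v w.
Proof. by move=> Du Dv Dw; rewrite psdDl ?psdNl//; exact: psd_domN. Qed.

Lemma psdDr u v w : D u -> D v -> D w -> b w (u + v) = b w u + b w v.
Proof.
move=> Du Dv Dw; rewrite (psd_sym _ _ psd)//; last exact: psd_domD.
by rewrite psdDl// !(psd_sym _ _ psd w).
Qed.

Lemma psdZr a u w : D u -> D w -> b w (a *: u) = a * b w u.
Proof.
move=> Du Dw; rewrite (psd_sym _ _ psd)//; last exact: psd_domZ.
by rewrite psdZl// (psd_sym _ _ psd w).
Qed.

Lemma psdNr u w : D u -> D w -> b w (- u) = - b w u.
Proof. by move=> Du Dw; rewrite -scaleN1r psdZr// mulN1r. Qed.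

Lemma psdBr u v w : D u -> D v -> D w -> b w (u - v) = b w u - b w v.
Proof. by move=> Du Dv Dw; rewrite psdDr ?psdNr//; exact: psd_domN. Qed.

Lemma psd_sqrD u v : D u -> D v -> b (u + v) (u + v) = b u u + 2 * b u v + b v v.
Proof.
move=> Du Dv; rewrite psdDl ?psdDr//; last exact: psd_domD.
by rewrite (psd_sym _ _ psd v u)//; ring.
Qed.

Lemma psd_sqrZ a u : D u -> b (a *: u) (a *: u) = a ^+ 2 * b u u.
Proof.
move=> Du; rewrite psdZl ?psdZr//; last exact: psd_domZ.
by ring.
Qed.

Lemma psd_sqrB u v : D u -> D v -> b (u - v) (u - v) = b u u - 2 * b u v + b v v.
Proof.
move=> Du Dv; rewrite psd_sqrD//; last exact: psd_domN.
by rewrite psdNl ?psdNr//; [ring|exact: psd_domN].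
Qed.

Lemma psd_sqrBC u v : D u -> D v -> b (u - v) (u - v) = b (v - u) (v - u).
Proof. by move=> Du Dv; rewrite !psd_sqrB// (psd_sym _ _ psd u v)//; ring. Qed.

Lemma psd_cauchy_schwarz u v : D u -> D v -> b u v ^+ 2 <= b u u * b v v.
Proof.
move=> Du Dv; have u0 := psd_ge0 _ _ psd _ Du; have v0 := psd_ge0 _ _ psd _ Dv.
have P (t s : R) : 0 <= t ^+ 2 * b u u - 2 * (t * s * b u v) + s ^+ 2 * b v v.
  have := psd_ge0 _ _ psd _ (psd_domB _ _ (psd_domZ t _ Du) (psd_domZ s _ Dv)).
  rewrite psd_sqrB; [|exact: psd_domZ..].
  by rewrite !psd_sqrZ// psdZl ?psdZr//; [rewrite (mulrA t)|exact: psd_domZ].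
have [vp|] := ltP 0 (b v v); last first.
  move=> vn; have vz : b v v = 0 by apply/eqP; rewrite eq_le vn.
  rewrite vz mulr0 leNgt; apply/negP => buv.
  (* Here [b v v = 0], and this choice turns the nonnegative polynomial into [- b u v ^+ 2]. *)
  have := P (b u v) ((b u u + 1) / 2); rewrite vz mulr0 addr0.
  have -> : 2 * (b u v * ((b u u + 1) / 2) * b u v) = b u v ^+ 2 * (b u u + 1) by field.
  by rewrite mulrDr mulr1 opprD addrA subrr add0r oppr_ge0 leNgt buv.
have := P (b v v) (b u v).
have -> : b v v ^+ 2 * b u u - 2 * (b v v * b u v * b u v) + b u v ^+ 2 * b v v =
  b v v * (b u u * b v v - b u v ^+ 2) by ring.
by rewrite pmulr_rge0// subr_ge0.
Qed.

Lemma seminorm_ge0 u : 0 <= N u. Proof. exact: sqrtr_ge0. Qed.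

Lemma sqr_seminorm u : D u -> N u ^+ 2 = b u u.
Proof. by move=> Du; rewrite sqr_sqrtr//; exact: (psd_ge0 _ _ psd). Qed.

Lemma psd_le_seminorm u v : D u -> D v -> `|b u v| <= N u * N v.
Proof.
move=> Du Dv; rewrite -sqrtrM; last exact: (psd_ge0 _ _ psd).
by rewrite -sqrtr_sqr ler_wsqrtr// psd_cauchy_schwarz.
Qed.

Lemma seminormD u v : D u -> D v -> N (u + v) <= N u + N v.
Proof.
move=> Du Dv; rewrite -(@ler_pXn2r _ 2)// ?nnegrE ?addr_ge0 ?sqrtr_ge0//.
rewrite sqr_seminorm; last exact: psd_domD.
rewrite psd_sqrD// sqrrD !sqr_seminorm//.
by have := le_trans (ler_norm _) (psd_le_seminorm _ _ Du Dv); lra.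
Qed.

Lemma seminormZ a u : D u -> N (a *: u) = `|a| * N u.
Proof. by move=> Du; rewrite /N psd_sqrZ// sqrtrM ?sqr_ge0// sqrtr_sqr. Qed.

Lemma seminormBC u v : D u -> D v -> N (u - v) = N (v - u).
Proof. by move=> Du Dv; rewrite /N psd_sqrBC. Qed.

Lemma seminorm_triangle w u v : D u -> D v -> D w -> N (u - v) <= N (u - w) + N (w - v).
Proof.
move=> Du Dv Dw; rewrite -[X in N X <= _](_ : (u - w) + (w - v) = _); last by rewrite addrA subrK.
by apply: seminormD; exact: psd_domB.
Qed.

Lemma seminorm_lt u e : 0 < e -> D u -> (N u < e) = (b u u < e ^+ 2).
Proof.
move=> e0 Du; rewrite -(@ltr_pXn2r _ 2)// ?nnegrE ?sqrtr_ge0// ?ltW//.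
by rewrite sqr_seminorm.
Qed.

End PsdFormTheory.

(** * Square-integrable functions *)

Section SquareIntegrable.
Context {d : measure_display} {R : realType} {E : borelMetricType d R}.
Variable m : {measure set E -> \bar R}.
Implicit Types u v w f : E -> R.

Definition L2 : set (E -> R) := [set u | u \in Lfun m 2%:E].

Lemma L2_measurable u : L2 u -> measurable_fun setT u.
Proof. by rewrite /L2/= inE => /andP[]; rewrite inE. Qed.

Lemma L2P u : measurable_fun setT u ->
  (\int[m]_x (u x ^+ 2)%:E < +oo)%E -> L2 u.
Proof.
move=> mu fu; rewrite /L2/= inE; apply/andP; split; rewrite inE//=.
rewrite /finite_norm unlock; apply: poweR_lty.
rewrite (eq_integral (fun x => (u x ^+ 2)%:E))// => x _ /=.
by rewrite (powR_mulrn 2)// real_normK// num_real.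
Qed.

Lemma L2_integrable u v : L2 u -> L2 v -> m.-integrable setT (EFin \o (u \* v)).
Proof. by move=> Lu Lv; apply/Lfun1_integrable; exact: Lfun2_mul_Lfun1. Qed.

Lemma inner_EFin u v : L2 u -> L2 v ->
  (inner m u v)%:E = (\int[m]_x (u x * v x)%:E)%E.
Proof.
move=> Lu Lv; rewrite /inner /Rintegral fineK//.
exact: (integrable_fin_num measurableT (L2_integrable _ _ Lu Lv)).
Qed.

Lemma L2sq_EFin u : L2 u -> (L2sq m u)%:E = (\int[m]_x (u x ^+ 2)%:E)%E.
Proof. by move=> Lu; rewrite inner_EFin//; apply: eq_integral => x _; rewrite expr2. Qed.

Lemma inner_psd : psd_form L2 (inner m).
Proof.
have p1 : (1 <= (2%:E : \bar R))%E by rewrite lee_fin ler1n.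
have [L0 Llin] := @Lfun_submod_closed _ E R m 2%:E p1.
split.
- exact: L0.
- by move=> a u v Lu Lv; exact: Llin.
- move=> a u v w Lu Lv Lw; rewrite /inner.
  have iu := L2_integrable _ _ Lu Lw; have iv := L2_integrable _ _ Lv Lw.
  rewrite -RintegralZl//= -RintegralD//=.
  + by apply: eq_Rintegral => x _; rewrite !fctE /=; change (a *: u x) with (a * u x); ring.
  + rewrite (_ : _ \o _ = (fun x => a%:E * (EFin \o (u \* w)%R) x)%E)//.
    exact: integrableZl.
- by move=> u v _ _; apply: eq_Rintegral => x _; rewrite mulrC.
- by move=> u _; apply: Rintegral_ge0 => x _; rewrite -expr2 sqr_ge0.
Qed.

Lemma inner_ae u v w : L2 u -> L2 v -> L2 w -> u = v %[ae m] ->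
  inner m u w = inner m v w.
Proof.
move=> Lu Lv Lw uv; apply: EFin_inj; rewrite !inner_EFin//.
have mp f : L2 f -> measurable_fun setT (fun x => (f x * w x)%:E).
  by move=> Lf; apply/measurable_EFinP/measurable_funM; exact: L2_measurable.
apply: ae_eq_integral => //; [exact: mp..|].
by apply: filterS uv => x /= /[apply] ->.
Qed.

Lemma L2sq_ae u v : L2 u -> L2 v -> u = v %[ae m] -> L2sq m u = L2sq m v.
Proof.
move=> Lu Lv uv; rewrite /L2sq (inner_ae u v)// (psd_sym _ _ inner_psd)//.
exact: inner_ae.
Qed.

Lemma L2sq0_ae u : L2 u -> L2sq m u = 0 -> u = 0 %[ae m].
Proof.
move=> Lu u0; have := L2sq_EFin _ Lu; rewrite u0 => /esym I0.
have mu2 : measurable_fun setT (fun x => (u x ^+ 2)%:E).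
  by apply/measurable_EFinP/measurable_funX; exact: L2_measurable.
have /(ae_eq_integral_abs m measurableT mu2) : (\int[m]_x `|(u x ^+ 2)%:E| = 0)%E.
  rewrite -[RHS]I0; apply: eq_integral => x _; rewrite gee0_abs// lee_fin sqr_ge0//.
apply: filterS => x /= /(_ I) [/eqP]; rewrite sqrf_eq0 => /eqP -> _.
by [].
Qed.

Lemma seminorm_ae u v : L2 u -> L2 v -> u = v %[ae m] ->
  seminorm (inner m) (u - v) = 0.
Proof.
move=> Lu Lv uv; rewrite /seminorm.
have L0 := psd_dom0 _ _ inner_psd.
have -> : inner m (u - v) (u - v) = L2sq m 0.
  apply: L2sq_ae => //; first exact: (psd_domB inner_psd).
  by apply: filterS uv => x /= /(_ I) h _; rewrite fctE /= h subrr.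
by rewrite /L2sq (psd0l inner_psd)// sqrtr0.
Qed.

Lemma le_L2 u v : measurable_fun setT u -> L2 v ->
  (\forall x \ae m, `|u x| <= `|v x|) -> L2 u.
Proof.
move=> mu Lv uv; apply: L2P => //.
apply: (@le_lt_trans _ _ (\int[m]_x (v x ^+ 2)%:E)%E).
  apply: ae_ge0_le_integral => //=.
  - by move=> x _; rewrite lee_fin sqr_ge0.
  - by apply/measurable_EFinP/measurable_funX.
  - by move=> x _; rewrite lee_fin sqr_ge0.
  - by apply/measurable_EFinP/measurable_funX; exact: L2_measurable.
  - apply: filterS uv => x h _; rewrite lee_fin.
    by rewrite -[_ ^+ 2]real_normK ?num_real// -[leRHS]real_normK ?num_real// lerXn2r.
by rewrite -L2sq_EFin// ltry.
Qed.

Lemma L2_normr u : L2 u -> L2 (fun x => `|u x|).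
Proof.
move=> Lu; apply: (le_L2 _ u) => //.
  by apply: measurableT_comp => //; exact: L2_measurable.
by apply: aeW => x; rewrite normr_id.
Qed.

Definition L2nneg : set (E -> R) := [set u | L2 u /\ \forall x \ae m, 0 <= u x].

Lemma inner_ge0 u v : L2nneg u -> L2nneg v -> 0 <= inner m u v.
Proof.
move=> [Lu u0] [Lv v0].
have Lu' := L2_normr _ Lu; have Lv' := L2_normr _ Lv.
rewrite (inner_ae u (fun x => `|u x|))//; last first.
  by apply: filterS u0 => x h _; rewrite ger0_norm.
rewrite (psd_sym _ _ inner_psd)// (inner_ae v (fun x => `|v x|))//; last first.
  by apply: filterS v0 => x h _; rewrite ger0_norm.
by apply: Rintegral_ge0 => x _; rewrite mulr_ge0.
Qed.

(* The negative part of [u] is dominated by the distance to any nonnegative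
   function, so it vanishes. *)
Lemma L2nneg_closed u : L2 u ->
  (forall e : R, 0 < e -> exists2 v, L2nneg v & seminorm (inner m) (u - v) < e) ->
  L2nneg u.
Proof.
move=> Lu cl; split => //.
pose n := fun x => Num.max (- u x) 0.
have mn : measurable_fun setT n.
  apply: measurable_maxr => //; apply: measurableT_comp => //; exact: L2_measurable.
have Ln : L2 n.
  apply: (le_L2 _ u) => //; apply: aeW => x; rewrite /n.
  by have [h|h] := leP (- u x) 0; [rewrite normr0|rewrite normrN].
suff n0 : L2sq m n = 0.
  have := L2sq0_ae _ Ln n0; apply: filterS => x /= /(_ I); rewrite /n.
  by have [h _|h /eqP] := leP (- u x) 0; [rewrite -oppr_le0|rewrite (gt_eqF h)].
apply/eqP; rewrite eq_le (psd_ge0 _ _ inner_psd)// andbT; apply/ler_addgt0Pr => e e0.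
rewrite add0r; have [v [Lv v0] +] := cl (Num.sqrt e) ltac:(by rewrite sqrtr_gt0).
have Luv := psd_domB inner_psd _ _ Lu Lv.
rewrite (seminorm_lt inner_psd)// ?sqrtr_gt0// (sqr_sqrtr (ltW e0)) => h.
apply: le_trans (ltW h); rewrite -lee_fin (L2sq_EFin (u - v))// L2sq_EFin//.
apply: ae_ge0_le_integral => //=.
- by move=> x _; rewrite lee_fin sqr_ge0.
- by apply/measurable_EFinP/measurable_funX.
- by move=> x _; rewrite lee_fin sqr_ge0.
- by apply/measurable_EFinP/measurable_funX; exact: L2_measurable.
- apply: filterS v0 => x v0 _; rewrite lee_fin /n /= -[(u - v) x]/(u x - v x).
  by have [h'|h'] := leP (- u x) 0; rewrite ?expr0n ?sqr_ge0//=; nra.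
Qed.

End SquareIntegrable.

(** * The resolvent of a closed form *)

Section Resolvent.
Context {d : measure_display} {R : realType} {E : borelMetricType d R}.
Variables (m : {measure set E -> \bar R}) (F : qform E).
Hypothesis sf : Defs.symmetric_form m F.
Local Notation ip := (inner m).
Local Notation N := (seminorm (inner m)).
Local Notation ipsd := (inner_psd m).

Lemma form_psd : psd_form (dom F) F.
Proof.
split; [exact: sf_dom0 sf|exact: sf_dom_lin sf|exact: sf_lin sf|exact: sf_sym sf|].
exact: sf_ge0 sf.
Qed.

Lemma dom_L2 u : dom F u -> L2 m u.
Proof. exact: sf_L2 sf _. Qed.

Definition shifted_form (a : R) (u v : E -> R) := F u v + a * ip u v.

Lemma shifted_form_psd a : 0 <= a -> psd_form (dom F) (shifted_form a).
Proof.
move=> a0; rewrite /shifted_form; split.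
- exact: sf_dom0 sf.
- exact: sf_dom_lin sf.
- move=> c u v w Du Dv Dw; rewrite (psd_lin _ _ form_psd)//.
  by rewrite (psd_lin _ _ ipsd)//; [ring|exact: dom_L2..].
- move=> u v Du Dv; rewrite (psd_sym _ _ form_psd)//.
  by rewrite (psd_sym _ _ ipsd)//; exact: dom_L2.
- move=> u Du; rewrite addr_ge0 ?(psd_ge0 _ _ form_psd)// mulr_ge0//.
  by apply: (psd_ge0 _ _ ipsd); exact: dom_L2.
Qed.

(** Together with [energy1_le_shifted_form], this makes all shifted forms with [a > 0] equivalent to
    the energy norm, so that closedness gives completeness for each of them. *)
Lemma shifted_form_le_energy1 a u : 0 < a -> dom F u ->
  shifted_form a u u <= (1 + a) * energy1 m F u.
Proof.
move=> a0 Du; rewrite /shifted_form /energy1 /L2sq.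
have := psd_ge0 _ _ form_psd _ Du; have := psd_ge0 _ _ ipsd _ (dom_L2 _ Du).
by nra.
Qed.

Lemma energy1_le_shifted_form a u : 0 < a -> dom F u ->
  energy1 m F u <= (1 + a^-1) * shifted_form a u u.
Proof.
move=> a0 Du; rewrite /shifted_form /energy1 /L2sq.
have h1 := psd_ge0 _ _ form_psd _ Du; have h2 := psd_ge0 _ _ ipsd _ (dom_L2 _ Du).
rewrite mulrDl mul1r mulrDr mulrA mulVf ?gt_eqF// mul1r.
have h3 : 0 <= a^-1 * F u u by rewrite mulr_ge0// invr_ge0 ltW.
have h4 : 0 <= a * ip u u by rewrite mulr_ge0// ltW.
lra.
Qed.

(* [u = a G_a f], where [G_a] is the resolvent of the form. *)
Definition is_resolvent (a : R) (f u : E -> R) := dom F u /\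
  forall v, dom F v -> F u v = a * ip (f - u) v.

(** * Existence of the resolvent by the direct method *)

Section Existence.
Variables (a : R) (f : E -> R).
Hypotheses (a0 : 0 < a) (Lf : L2 m f).

(** Its minimiser is [a G_a f]: by [resolvent_functionalD], the first variation in direction [v] is
    [2 (B u v - a (f, v))]. *)
Definition resolvent_functional (u : E -> R) := shifted_form a u u - 2 * a * ip f u.
Local Notation J := resolvent_functional.
Local Notation B := (shifted_form a).
Local Notation bpsd := (shifted_form_psd a (ltW a0)).

Lemma resolvent_functionalD u v : dom F u -> dom F v ->
  J (u + v) = J u + 2 * (B u v - a * ip f v) + B v v.
Proof.
move=> Du Dv; rewrite /J (psd_sqrD bpsd)// (psdDr ipsd)//; [ring|exact: dom_L2..].
Qed.

Lemma resolvent_functionalZ c u : dom F u ->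
  J (c *: u) = c ^+ 2 * B u u - 2 * a * c * ip f u.
Proof.
move=> Du; rewrite /J (psd_sqrZ bpsd)// (psdZr ipsd)//; [ring|exact: dom_L2].
Qed.

(** Completing the square, [J u = F u u + a (f - u, f - u) - a (f, f)]. *)
Lemma resolvent_functional_lb u : dom F u -> - (a * ip f f) <= J u.
Proof.
move=> Du; have Lu := dom_L2 _ Du; rewrite /J /shifted_form.
have h1 := psd_ge0 _ _ form_psd _ Du.
have := psd_ge0 _ _ ipsd _ (psd_domB ipsd _ _ Lf Lu); rewrite (psd_sqrB ipsd)//.
by move=> /(mulr_ge0 (ltW a0)); lra.
Qed.

(** The parallelogram identity, in which the linear parts cancel. As [J] at the midpoint is at least
    the infimum, it makes minimising sequences Cauchy. *)
Lemma resolvent_functional_parallelogram u v : dom F u -> dom F v ->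
  B (u - v) (u - v) = 2 * J u + 2 * J v - 4 * J (2^-1 *: (u + v)).
Proof.
move=> Du Dv; have Duv := psd_domD form_psd _ _ Du Dv.
rewrite resolvent_functionalZ// (psd_sqrB bpsd)// (psd_sqrD bpsd)// (psdDr ipsd)//;
  [|exact: dom_L2..].
by rewrite /J; field.
Qed.

Hypothesis cl : closed_form m F.

(** A minimising sequence is Cauchy, and closedness provides a limit [u]. The equation for [u] is
    obtained by estimating the first variation at the almost minimisers [u_ n] and passing to the
    limit. *)
Lemma resolvent_exists : exists u, is_resolvent a f u.
Proof.
pose S := [set J u | u in dom F].
have hS : has_inf S.
  split; first by exists (J 0), 0 => //; exact: sf_dom0 sf.
  by exists (- (a * ip f f)) => _ [u Du <-]; exact: resolvent_functional_lb.
pose i := inf S.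
have iJ u : dom F u -> i <= J u.
  by move=> Du; apply: ge_inf; [exact: hS.2|exists u].
have /choice[u_ /all_and2[Du_ Ju_]] :
    forall n : nat, exists u, dom F u /\ J u < i + n.+1%:R^-1.
  move=> n; have n0 : 0 < n.+1%:R^-1 :> R by rewrite invr_gt0.
  by have [_ [u Du <-] Ju] := inf_adherent n0 hS; exists u.
have a1 : 0 < 1 + a^-1 by rewrite addr_gt0// invr_gt0.
have /(cl _ Du_) : cauchy_for (energy1 m F) u_.
  move=> e e0.
  (* The shifted form of [u_ n - u_ k] is at most [2 / n.+1 + 2 / k.+1], and passing to [energy1]
     costs a factor [1 + a^-1]. *)
  have e'0 : 0 < e / (4 * (1 + a^-1)) by rewrite divr_gt0// mulr_gt0.
  have [n0 _ n0P] := near_infty_natSinv_lt (PosNum e'0).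
  exists n0 => n k nn kn.
  have Dnk := psd_domB form_psd _ _ (Du_ n) (Du_ k).
  apply: (le_lt_trans (energy1_le_shifted_form _ _ a0 Dnk)).
  rewrite resolvent_functional_parallelogram//.
  have Dm := psd_domZ form_psd 2^-1 _ (psd_domD form_psd _ _ (Du_ n) (Du_ k)).
  have h5 : n.+1%:R^-1 < e / (4 * (1 + a^-1)) := n0P n nn.
  have h4 : k.+1%:R^-1 < e / (4 * (1 + a^-1)) := n0P k kn.
  rewrite !ltr_pdivlMr ?mulr_gt0// in h4 h5.
  have h3 := Ju_ n; have h2 := Ju_ k; have h1 := iJ _ Dm.
  move: (n.+1%:R^-1) (k.+1%:R^-1) h2 h3 h4 h5 => dn dk h2 h3 h4 h5.
  have : 2 * J (u_ n) + 2 * J (u_ k) - 4 * J (2^-1 *: (u_ n + u_ k)) <=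
    2 * dn + 2 * dk by lra.
  rewrite -(ler_pM2l a1) => /le_lt_trans; apply; lra.
move=> [u Du cu]; exists u; split => [//|v Dv].
have X0 : B u v - a * ip f v = 0.
  set X := _ - _; apply/eqP; rewrite -sqrf_eq0 eq_le sqr_ge0 andbT.
  apply/ler_addgt0Pr => /= e e0; rewrite add0r.
  have c0 := psd_ge0 _ _ bpsd _ Dv; set c := B v v in c0.
  (* [X ^+ 2 <= 2 Xn ^+ 2 + 2 B (u_ n - u) v ^+ 2]; the first two summands of [K] are the factors
     with which these terms are bounded by [e / K], and the 1 keeps [K] positive. *)
  pose K := 2 * (c + 1) + 2 * ((1 + a) * c) + 1.
  have ac := mulr_ge0 (ltW a0) c0.
  have K0 : 0 < K by rewrite /K; lra.
  have eK : 0 < e / K by rewrite divr_gt0.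
  have /cvgr0Pnorm_lt/(_ _ eK) nu := cu.
  have nd := near_infty_natSinv_lt (PosNum eK).
  near \oo => n.
  have dn : n.+1%:R^-1 < e / K by near: n.
  have en : energy1 m F (u_ n - u) < e / K.
    by apply: le_lt_trans (ler_norm _) _; near: n.
  have [dl {}dn Jn] : exists2 dl : R, dl < e / K & J (u_ n) < i + dl.
    by exists n.+1%:R^-1.
  have Dw := psd_domB form_psd _ _ (Du_ n) Du.
  pose Xn := B (u_ n) v - a * ip f v.
  (* [J (u_ n + s v)] is at least the infimum, which [J (u_ n)] exceeds by less than [dl]. *)
  have Q (s : R) : 0 <= 2 * s * Xn + s ^+ 2 * c + dl.
    have Ds := psd_domZ form_psd s _ Dv.
    have := iJ _ (psd_domD form_psd _ _ (Du_ n) Ds).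
    rewrite resolvent_functionalD// (psd_sqrZ bpsd)// (psdZr bpsd)// (psdZr ipsd)//;
      [|exact: dom_L2].
    by rewrite -/c /Xn; lra.
  have Xn2 : Xn ^+ 2 <= (c + 1) * dl.
    have c1 : 0 < c + 1 by lra.
    (* Nearly the minimiser of the quadratic polynomial in [s]; [c + 1] replaces [c], which may be
       0. *)
    have := Q (- Xn / (c + 1)).
    have -> : 2 * (- Xn / (c + 1)) * Xn + (- Xn / (c + 1)) ^+ 2 * c + dl =
      dl - Xn ^+ 2 / (c + 1) - Xn ^+ 2 / (c + 1) ^+ 2.
      by field; rewrite gt_eqF.
    have : 0 <= Xn ^+ 2 / (c + 1) ^+ 2 by rewrite divr_ge0 ?sqr_ge0.
    move=> h1 h2; have : Xn ^+ 2 / (c + 1) <= dl by lra.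
    by rewrite ler_pdivrMr// mulrC.
  have Bn : B (u_ n - u) v ^+ 2 <= (1 + a) * (e / K) * c.
    apply: (le_trans (psd_cauchy_schwarz bpsd _ _ Dw Dv)).
    apply: ler_wpM2r => //; apply: (le_trans (shifted_form_le_energy1 _ _ a0 Dw)).
    by apply: ler_wpM2l; [rewrite addr_ge0// ltW|exact: ltW].
  have -> : X = Xn - B (u_ n - u) v by rewrite (psdBl bpsd)// /X /Xn; ring.
  have : (Xn - B (u_ n - u) v) ^+ 2 <= 2 * Xn ^+ 2 + 2 * B (u_ n - u) v ^+ 2.
    by have := sqr_ge0 (Xn + B (u_ n - u) v); lra.
  move=> /le_trans; apply.
  have h : (c + 1) * dl <= (c + 1) * (e / K).
    by apply: ler_wpM2l; [rewrite addr_ge0|exact: ltW].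
  have -> : e = (e / K) * K by rewrite divfK// gt_eqF.
  by move: (e / K) (eK) Bn h => ek ek0 Bn h; rewrite /K; lra.
rewrite (psdBl ipsd)//; [|exact: dom_L2..].
by move: X0; rewrite /shifted_form; lra.
Unshelve. all: by end_near.
Qed.

End Existence.

End Resolvent.

(** * Contraction and strong convergence of the resolvent *)

Section ResolventTheory.
Context {d : measure_display} {R : realType} {E : borelMetricType d R}.
Variables (m : {measure set E -> \bar R}) (F : qform E).
Hypotheses (sf : Defs.symmetric_form m F) (cl : closed_form m F).
Local Notation ip := (inner m).
Local Notation N := (seminorm (inner m)).
Local Notation ipsd := (inner_psd m).
Local Notation fpsd := (form_psd m F sf).
Local Notation domL2 := (dom_L2 m F sf).

(** Testing the difference of the two equations with [w = u - u'], [F w w >= 0] gives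
    [(w, w) <= (f - f', w)]; then Cauchy-Schwarz. *)
Lemma resolvent_contraction a f f' u u' : 0 < a -> L2 m f -> L2 m f' ->
  is_resolvent m F a f u -> is_resolvent m F a f' u' -> N (u - u') <= N (f - f').
Proof.
move=> a0 Lf Lf' [Du Fu] [Du' Fu'].
have Lu := domL2 _ Du; have Lu' := domL2 _ Du'.
have Dw := psd_domB fpsd _ _ Du Du'; have Lw := domL2 _ Dw.
have := psd_ge0 _ _ fpsd _ Dw.
rewrite {1}(psdBl fpsd)// Fu// Fu'// -mulrBr pmulr_rge0//.
rewrite (psdBl ipsd f)// (psdBl ipsd f')// => h.
have : ip (u - u') (u - u') <= ip (f - f') (u - u').
  by rewrite {1}(psdBl ipsd)// (psdBl ipsd f)//; lra.
have Lff' := psd_domB ipsd _ _ Lf Lf'.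
move=> /le_trans/(_ (le_trans (ler_norm _) (psd_le_seminorm ipsd _ _ Lff' Lw))).
rewrite -(sqr_seminorm ipsd)// expr2.
have := seminorm_ge0 (b := ip) (u - u'); rewrite le_eqVlt => /orP[/eqP <- _|N0].
  exact: seminorm_ge0.
by rewrite ler_pM2r.
Qed.

Lemma resolvent_unique a f u u' : 0 < a -> L2 m f ->
  is_resolvent m F a f u -> is_resolvent m F a f u' -> N (u - u') = 0.
Proof.
move=> a0 Lf ru ru'; apply/eqP; rewrite eq_le seminorm_ge0 andbT.
apply: le_trans (resolvent_contraction _ _ _ _ _ a0 Lf Lf ru ru') _.
by rewrite subrr /seminorm (psd0l ipsd) ?sqrtr0//; exact: (psd_dom0 _ _ ipsd).
Qed.

(** Testing with [w = v - u] gives [a (w, w) = F v w - F w w], while [2 F v w <= F v v + F w w]. *)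
Lemma resolvent_dom_dist a v u : 0 < a -> dom F v -> is_resolvent m F a v u ->
  N (v - u) ^+ 2 <= F v v / a.
Proof.
move=> a0 Dv [Du Fu]; have Dw := psd_domB fpsd _ _ Dv Du.
rewrite (sqr_seminorm ipsd); last exact: domL2.
rewrite ler_pdivlMr// mulrC -Fu//.
have h1 : F (v - u) (v - u) = F v (v - u) - F u (v - u) by rewrite {1}(psdBl fpsd).
have := psd_ge0 _ _ fpsd _ (psd_domB fpsd _ _ Dv Dw); rewrite (psd_sqrB fpsd)//.
have := psd_ge0 _ _ fpsd _ Dv; have := psd_ge0 _ _ fpsd _ Dw.
lra.
Qed.

(** On the domain [resolvent_dom_dist] gives convergence; density and contraction carry it to L^2,
    with three errors below [e / 4]. *)
Lemma resolvent_cvg f e : L2 m f -> 0 < e ->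
  exists2 a0 : R, 0 < a0 & forall a u, a0 <= a -> is_resolvent m F a f u -> N (u - f) < e.
Proof.
move=> Lf e0; have e40 : 0 < (e / 4) by rewrite divr_gt0.
have [v Dv fv] := sf_dense sf Lf (exprn_gt0 2 e40).
have Lv := domL2 _ Dv; have Lfv := psd_domB ipsd _ _ Lf Lv.
have {}fv : N (f - v) < e / 4 by rewrite (seminorm_lt ipsd).
have c0 := psd_ge0 _ _ fpsd _ Dv.
exists ((F v v + 1) / (e / 4) ^+ 2).
  by rewrite divr_gt0 ?exprn_gt0//; lra.
move=> a u aa ru.
have a0 : 0 < a by apply: lt_le_trans aa; rewrite divr_gt0 ?exprn_gt0//; lra.
have [w rw] := resolvent_exists m F sf a v a0 Lv cl.
have Lu := domL2 _ ru.1; have Lw := domL2 _ rw.1.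
have h1 := resolvent_contraction _ _ _ _ _ a0 Lf Lv ru rw.
have h2 : N (v - w) < e / 4.
  rewrite -(@ltr_pXn2r _ 2)// ?nnegrE ?sqrtr_ge0 ?(ltW e40)//.
  apply: le_lt_trans (resolvent_dom_dist _ _ _ a0 Dv rw) _.
  move: aa; rewrite ler_pdivrMr ?exprn_gt0// => aa.
  by rewrite ltr_pdivrMr//; lra.
have h3 := seminorm_triangle ipsd w _ _ Lu Lf Lw.
have h4 := seminorm_triangle ipsd v _ _ Lw Lf Lv.
rewrite (seminormBC ipsd w v)// (seminormBC ipsd v f)// in h4.
lra.
Qed.

End ResolventTheory.

(** * Semigroups and resolvents *)

Section SemigroupTheory.
Context {d : measure_display} {R : realType} {E : borelMetricType d R}.
Variables (m : {measure set E -> \bar R}) (F : qform E) (T : R -> (E -> R) -> (E -> R)).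
Hypotheses (sf : Defs.symmetric_form m F) (cl : closed_form m F).
Hypothesis sgF : semigroup_of m F T.
Local Notation ip := (inner m).
Local Notation N := (seminorm (inner m)).
Local Notation ipsd := (inner_psd m).
Local Notation fpsd := (form_psd m F sf).
Local Notation domL2 := (dom_L2 m F sf).
Local Notation sg := sgF.1.

Lemma sgB t u v : 0 < t -> L2 m u -> L2 m v -> T t (u - v) = T t u - T t v %[ae m].
Proof.
move=> t0 Lu Lv; have := sg_lin sg (-1) t0 Lv Lu.
by rewrite scaleN1r addrC scaleN1r [- T t v + _]addrC.
Qed.

(** The semigroup is specified at positive times only; the identity at the other times lets the time
    grids below start at 0. *)
Definition sg0 (t : R) (u : E -> R) := if 0 < t then T t u else u.

Lemma sg0E t u : 0 < t -> sg0 t u = T t u.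
Proof. by rewrite /sg0 => ->. Qed.

Lemma sg00 u : sg0 0 u = u.
Proof. by rewrite /sg0 ltxx. Qed.

Lemma sg0_L2 t u : L2 m u -> L2 m (sg0 t u).
Proof. by rewrite /sg0; case: ifPn => // t0 Lu; exact: (sg_L2 sg). Qed.

Lemma sg0_contract t u : L2 m u -> N (sg0 t u) <= N u.
Proof. by rewrite /sg0; case: ifPn => // t0 Lu; rewrite ler_wsqrtr//; exact: (sg_contract sg). Qed.

Lemma sg0_dist t u v : L2 m u -> L2 m v -> N (sg0 t u - sg0 t v) <= N (u - v).
Proof.
move=> Lu Lv; have Luv := psd_domB ipsd _ _ Lu Lv.
apply: le_trans (sg0_contract t _ Luv); rewrite /sg0; case: ifPn => // t0.
rewrite /seminorm ler_wsqrtr// -[leLHS]/(L2sq m _) -[leRHS]/(L2sq m _).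
rewrite (L2sq_ae m (T t (u - v)) (T t u - T t v))//.
- exact: (sg_L2 sg).
- by apply: (psd_domB ipsd); exact: (sg_L2 sg).
- exact: sgB.
Qed.

Lemma sg0_add s t u : 0 <= s -> 0 <= t -> L2 m u -> sg0 (s + t) u = sg0 s (sg0 t u) %[ae m].
Proof.
rewrite !le_eqVlt => /orP[/eqP <- _|s0 /orP[/eqP <- |t0]] Lu.
  by rewrite add0r sg00; exact: ae_eq_refl.
  by rewrite addr0 sg00; exact: ae_eq_refl.
rewrite !sg0E ?addr_gt0//; exact: (sg_add sg).
Qed.

Lemma sg0_sym t u v : L2 m u -> L2 m v -> ip (sg0 t u) v = ip u (sg0 t v).
Proof. by rewrite /sg0; case: ifPn => // t0 Lu Lv; exact: (sg_sym sg). Qed.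

(** The resolvent equation reads [F u v = (a (f - u), v)], which says that the generator maps [u] to
    [- a (f - u)]. *)
Lemma resolvent_generator a f u : L2 m f -> is_resolvent m F a f u ->
  L2sq m (t^-1 *: (T t u - u) + a *: (f - u)) @[t --> 0^'+] --> (0 : R).
Proof.
move=> Lf [Du Fu]; have Lu := domL2 _ Du; have Lfu := psd_domB ipsd _ _ Lf Lu.
apply/(sgF.2 u (a *: (f - u)) Lu (psd_domZ ipsd a _ Lfu)); split => // v Dv.
by rewrite Fu// (psdZl ipsd)//; exact: domL2.
Qed.

(** [T t] maps the difference quotients of [u] to those of [T t u] and is a contraction, so their
    convergence persists; the characterisation of the generator turns it back into the resolvent
    equation. *)
Lemma sg_resolvent_commute a f u t : 0 < t -> L2 m f -> is_resolvent m F a f u ->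
  is_resolvent m F a (T t f) (T t u).
Proof.
move=> t0 Lf ru; have Lu := domL2 _ ru.1.
have LT s g : 0 < s -> L2 m g -> L2 m (T s g) by exact: (sg_L2 sg).
have Lfu := psd_domB ipsd _ _ Lf Lu.
have LTfu := psd_domB ipsd _ _ (LT t _ t0 Lf) (LT t _ t0 Lu).
suff : dom F (T t u) /\ forall v, dom F v -> F (T t u) v = ip (a *: (T t f - T t u)) v.
  move=> [DTu h]; split => // v Dv; rewrite h// (psdZl ipsd)//; exact: domL2.
apply/(sgF.2 _ _ (LT t _ t0 Lu) (psd_domZ ipsd a _ LTfu)).
apply: (squeeze_cvgr _ (cvg_cst 0) (resolvent_generator a f u Lf ru)).
near=> s; have s0 : 0 < s by [].
have L1 := psd_domB ipsd _ _ (LT s _ s0 Lu) Lu.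
have L2' := psd_domD ipsd _ _ (psd_domZ ipsd s^-1 _ L1) (psd_domZ ipsd a _ Lfu).
have L3 : L2 m (s^-1 *: (T s (T t u) - T t u) + a *: (T t f - T t u)).
  apply: (psd_dom_lin _ _ ipsd); last exact: (psd_domZ ipsd).
  exact: (psd_domB ipsd _ _ (LT _ _ s0 (LT _ _ t0 Lu)) (LT _ _ t0 Lu)).
apply/andP; split; first exact: (psd_ge0 _ _ ipsd).
apply: le_trans (sg_contract sg t0 L2').
rewrite (L2sq_ae m _ (T t (s^-1 *: (T s u - u) + a *: (f - u))))//; first exact: LT.
have h1 := sg_lin sg s^-1 t0 L1 (psd_domZ ipsd a _ Lfu).
have h2 := sgB t _ _ t0 (LT s _ s0 Lu) Lu.
have h3 := sg_lin sg a t0 Lfu (psd_dom0 _ _ ipsd).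
have h4 := sg_add sg t0 s0 Lu.
have h5 := sg_add sg s0 t0 Lu.
have h6 := sgB t _ _ t0 Lf Lu.
have h7 := sgB t 0 0 t0 (psd_dom0 _ _ ipsd) (psd_dom0 _ _ ipsd).
rewrite subrr in h7; rewrite addr0 in h3; rewrite [t + s]addrC in h4.
(* Linearity and the semigroup law hold only almost everywhere, so they are all applied at a generic
   point. *)
near=> x => _.
have -> : T t (s^-1 *: (T s u - u) + a *: (f - u)) x =
    s^-1 * T t (T s u - u) x + T t (a *: (f - u)) x.
  by near: x; apply: filterS h1 => x /(_ Logic.I).
have -> : T t (T s u - u) x = T t (T s u) x - T t u x.
  by near: x; apply: filterS h2 => x /(_ Logic.I).
have -> : T t (a *: (f - u)) x = a * T t (f - u) x + T t 0 x.
  by near: x; apply: filterS h3 => x /(_ Logic.I).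
have -> : T t (f - u) x = T t f x - T t u x.
  by near: x; apply: filterS h6 => x /(_ Logic.I).
have -> : T t 0 x = 0.
  by near: x; apply: filterS h7 => x /(_ Logic.I) ->; rewrite fctE subrr.
have <- : T (s + t) u x = T t (T s u) x.
  by near: x; apply: filterS h4 => x /(_ Logic.I).
have -> : T (s + t) u x = T s (T t u) x.
  by near: x; apply: filterS h5 => x /(_ Logic.I).
by rewrite addr0.
Unshelve. all: by end_near.
Qed.

End SemigroupTheory.

Section SemigroupApproximation.
Context {d : measure_display} {R : realType} {E : borelMetricType d R}.
Variables (m : {measure set E -> \bar R}) (F : qform E) (T : R -> (E -> R) -> (E -> R)).
Hypotheses (sf : Defs.symmetric_form m F) (cl : closed_form m F).
Hypothesis sgF : semigroup_of m F T.
Local Notation ip := (inner m).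
Local Notation N := (seminorm (inner m)).
Local Notation ipsd := (inner_psd m).
Local Notation fpsd := (form_psd m F sf).
Local Notation domL2 := (dom_L2 m F sf).
Local Notation sg := sgF.1.
Local Notation S := (sg0 T).
Local Notation SL2 := (sg0_L2 m F T sgF).

Lemma at_right0_lt (P : R -> Prop) : (\forall t \near (0 : R)^'+, P t) ->
  exists2 e : R, 0 < e & forall t, 0 < t -> t < e -> P t.
Proof.
move=> [e /= e0 He]; exists e => // t t0 te; apply: He => //=.
by rewrite sub0r normrN gtr0_norm.
Qed.

Lemma resolvent_generator_lt a f u e : L2 m f -> is_resolvent m F a f u -> 0 < e ->
  exists2 del : R, 0 < del &
    forall t, 0 < t -> t < del -> N (t^-1 *: (T t u - u) + a *: (f - u)) < e.
Proof.
move=> Lf ru e0; have e20 : 0 < e ^+ 2 by rewrite exprn_gt0.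
have /cvgr0Pnorm_lt/(_ _ e20)/at_right0_lt[del del0 H] :=
  resolvent_generator m F T sf sgF a f u Lf ru.
exists del => // t t0 td; have Lu := domL2 _ ru.1.
rewrite (seminorm_lt ipsd)//; first exact: le_lt_trans (ler_norm _) (H t t0 td).
apply: (psd_dom_lin _ _ ipsd).
  by apply: (psd_domB ipsd) => //; exact: (sg_L2 sg).
by apply: (psd_domZ ipsd); exact: (psd_domB ipsd).
Qed.

(** [u] is an implicit Euler step of length [h]. With [q = a (f0 - f)], both [T_h f] and
    [u = f - h r] equal [f - h q] up to [o(h)]: the former by the generator, the latter because [r],
    the resolvent of [q] at [h^-1], converges to [q]. *)
Lemma sg_resolvent_gap a f0 f e : 0 < a -> L2 m f0 -> is_resolvent m F a f0 f -> 0 < e ->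
  exists2 del : R, 0 < del & forall h u, 0 < h -> h < del ->
    is_resolvent m F h^-1 f u -> N (T h f - u) <= h * e.
Proof.
move=> a0 Lf0 rf e0; have Lf := domL2 _ rf.1.
have e20 : 0 < e / 2 by rewrite divr_gt0.
have [del1 del10 H1] := resolvent_generator_lt _ _ _ _ Lf0 rf e20.
pose q := a *: (f0 - f).
have Lq : L2 m q by apply: (psd_domZ ipsd); exact: (psd_domB ipsd).
have [a1 a10 H2] := resolvent_cvg m F sf cl q _ Lq e20.
exists (Num.min del1 a1^-1); first by rewrite lt_min del10 invr_gt0.
move=> h u h0; rewrite lt_min => /andP[hd ha] ru.
have hV : 0 < h^-1 by rewrite invr_gt0.
have [r rr] := resolvent_exists m F sf h^-1 q hV Lq cl.
have rq : N (r - q) < e / 2.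
  by apply: (H2 h^-1) => //; rewrite ltW// -[a1]invrK ltf_pV2// posrE invr_gt0.
have Lr := domL2 _ rr.1; have Du := ru.1; have Lu := domL2 _ Du.
have Dfh : dom F (f - h *: r).
  by apply: (psd_domB fpsd); [exact: rf.1|apply: (psd_domZ fpsd); exact: rr.1].
have Lfh := domL2 _ Dfh; have Lhr := psd_domZ ipsd h _ Lr.
have rfh : is_resolvent m F h^-1 f (f - h *: r).
  split => // v Dv; have Lv := domL2 _ Dv.
  have Dr := rr.1; have Df := rf.1.
  rewrite (psdBl fpsd)//; last exact: (psd_domZ fpsd).
  rewrite (psdZl fpsd)// rr.2// rf.2// subKr.
  have Lf0f := psd_domB ipsd _ _ Lf0 Lf.
  rewrite -(psdZl ipsd a)// -/q (psdBl ipsd)// (psdZl ipsd h)//.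
  by field; rewrite gt_eqF.
have u0 := resolvent_unique m F sf _ _ _ _ hV Lf rfh ru.
have LTf := sg_L2 sg h0 Lf.
apply: le_trans (seminorm_triangle ipsd _ _ _ LTf Lu Lfh) _; rewrite u0 addr0.
have LTff := psd_domB ipsd _ _ LTf Lf.
have -> : T h f - (f - h *: r) = h *: (h^-1 *: (T h f - f) + q) + h *: (r - q).
  rewrite -scalerDr addrACA subrr addr0 scalerDr scalerA divff ?gt_eqF// scale1r.
  by rewrite opprB addrA addrAC.
have L1 : L2 m (h^-1 *: (T h f - f) + q) by exact: (psd_dom_lin _ _ ipsd).
have L3 := psd_domB ipsd _ _ Lr Lq.
have := seminormD ipsd _ _ (psd_domZ ipsd h _ L1) (psd_domZ ipsd h _ L3).
rewrite !(seminormZ ipsd)// gtr0_norm// => /le_trans; apply.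
rewrite -mulrDr ler_pM2l//; have := H1 h h0 hd; lra.
Qed.

(** * From the resolvent to the semigroup by the exponential formula *)

Section Cone.
Variable P : set (E -> R).
Hypotheses (P_L2 : P `<=` L2 m)
  (P_closed : forall u, L2 m u ->
    (forall e : R, 0 < e -> exists2 p, P p & N (u - p) < e) -> P u)
  (P_resolvent : forall a f u, 0 < a -> P f -> is_resolvent m F a f u -> P u).

(* [T_t f] is the limit of [((n/t) G_{n/t})^n f]: since the resolvent commutes
   with the semigroup and is a contraction, the [n] errors, each [o(t/n)], add. *)
Lemma sg_cone_range a f0 f t : 0 < a -> L2 m f0 -> is_resolvent m F a f0 f -> 0 < t ->
  P f -> P (T t f).
Proof.
move=> a0 Lf0 rf t0 Pf; have Lf := P_L2 _ Pf.
apply: P_closed; first exact: (sg_L2 sg).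
move=> e e0; have e'0 : 0 < e / (2 * t) by rewrite divr_gt0// mulr_gt0.
have [del del0 H] := sg_resolvent_gap _ _ _ _ a0 Lf0 rf e'0.
have [n _ /(_ n (leqnn n)) /= nP] := near_infty_natSinv_lt (PosNum (divr_gt0 del0 t0)).
pose h := t / n.+1%:R; have h0 : 0 < h by rewrite divr_gt0.
have hd : h < del by move: nP; rewrite ltr_pdivlMr// mulrC.
have hV : 0 < h^-1 by rewrite invr_gt0.
have [u ru] := resolvent_exists m F sf h^-1 f hV Lf cl.
have gap := H h u h0 hd ru.
have Lu := domL2 _ ru.1; have LTf := sg_L2 sg h0 Lf.
(* After [k] Euler steps the error is at most [k] times that of one step: [T_(k h)] is applied to
   the first step, and the contraction of the resolvent, which commutes with it, handles the others.
   For [k h = t] the total is [e / 2]. *)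
have step k : exists2 p, P p & N (S (k%:R * h) f - p) <= k%:R * (h * (e / (2 * t))).
  elim: k => [|k [p Pp Hp]].
    exists f => //; rewrite !mul0r sg00 subrr /seminorm (psd0l ipsd) ?sqrtr0//.
    exact: (psd_dom0 _ _ ipsd).
  have Lp := P_L2 _ Pp.
  have [p' rp'] := resolvent_exists m F sf h^-1 p hV Lp cl.
  exists p'; first exact: P_resolvent rp'.
  have Lp' := domL2 _ rp'.1.
  have kh0 : 0 <= k%:R * h by rewrite mulr_ge0// ltW.
  have LSf := SL2 (k%:R * h) _ Lf; have LSu := SL2 (k%:R * h) _ Lu.
  have LSTf := SL2 (k%:R * h) _ LTf.
  have LSk1 := SL2 (k.+1%:R * h) _ Lf.
  have h1 : N (S (k.+1%:R * h) f - S (k%:R * h) (T h f)) = 0.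
    apply: seminorm_ae => //; rewrite -natr1 mulrDl mul1r -[T h f]sg0E//.
    by apply: (sg0_add m F T sgF) => //; exact: ltW.
  have h2 := le_trans (sg0_dist m F T sgF (k%:R * h) _ _ LTf Lu) gap.
  have h3 : N (S (k%:R * h) u - p') <= N (S (k%:R * h) f - p).
    have rS : is_resolvent m F h^-1 (S (k%:R * h) f) (S (k%:R * h) u).
      rewrite /sg0; case: ifPn => // kh; exact: (sg_resolvent_commute m F T sf sgF).
    exact: (resolvent_contraction m F sf _ _ _ _ _ hV LSf Lp rS rp').
  have h4 := seminorm_triangle ipsd _ _ _ LSk1 Lp' LSTf.
  have h5 := seminorm_triangle ipsd _ _ _ LSTf Lp' LSu.
  have -> : k.+1%:R * (h * (e / (2 * t))) = k%:R * (h * (e / (2 * t))) + h * (e / (2 * t)).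
    by rewrite -natr1 mulrDl mul1r.
  lra.
have [p Pp Hp] := step n.+1; exists p => //.
have ht : n.+1%:R * h = t by rewrite /h mulrC divfK// pnatr_eq0.
move: Hp; rewrite mulrA ht sg0E// => /le_lt_trans; apply.
have -> : t * (e / (2 * t)) = e / 2 by field; rewrite gt_eqF.
lra.
Qed.

(** [f] is approximated inside [P] by its resolvents, to which [sg_cone_range] applies, and [T t] is
    a contraction. *)
Lemma sg_cone f t : 0 < t -> P f -> P (T t f).
Proof.
move=> t0 Pf; have Lf := P_L2 _ Pf; have LTf := sg_L2 sg t0 Lf.
apply: P_closed => // e e0.
have [a a0 H] := resolvent_cvg m F sf cl f e Lf e0.
have [u ru] := resolvent_exists m F sf a f a0 Lf cl.
have Lu := domL2 _ ru.1.
exists (T t u).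
  apply: (sg_cone_range a f) => //; exact: P_resolvent ru.
apply: le_lt_trans (H a u (lexx a) ru); rewrite (seminormBC ipsd u)//.
by have := sg0_dist m F T sgF t _ _ Lf Lu; rewrite !sg0E.
Qed.

End Cone.

(* With [D = (T_h v - v) / h + (f - a v)], the sum telescopes up to the error
   terms in [D] and [a]. *)
Lemma sg_riemann_sum_le a f v (n : nat) (h : R) : 0 < a -> 0 < h -> L2 m f -> dom F v ->
  h * \sum_(k < n) ip (S (k%:R * h) f) f <=
    ip f v - ip (S (n%:R * h) f) v + n%:R * h * (a * N f * N v) +
    n%:R * h * (N f * N (h^-1 *: (T h v - v) + (f - a *: v))).
Proof.
move=> a0 h0 Lf Dv; have Lv := domL2 _ Dv; have LTv := sg_L2 sg h0 Lv.
set D := _ *: _ + _.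
have Lav := psd_domZ ipsd a _ Lv; have LTvv := psd_domB ipsd _ _ LTv Lv.
have LD : L2 m D by apply: (psd_dom_lin _ _ ipsd) => //; exact: (psd_domB ipsd).
elim: n => [|n IH].
  by rewrite big_ord0 !mul0r sg00 subrr mulr0 !addr0.
rewrite big_ord_recr /= mulrDr.
set w := S (n%:R * h) f; have Lw : L2 m w by exact: SL2.
have nh0 : 0 <= n%:R * h by rewrite mulr_ge0// ltW.
have E1 : ip (S (n.+1%:R * h) f) v = ip w (T h v).
  have LST := SL2 h _ Lw.
  have -> : ip (S (n.+1%:R * h) f) v = ip (S h w) v.
    apply: inner_ae => //; first exact: SL2.
    by rewrite -natr1 mulrDl mul1r addrC; apply: (sg0_add m F T sgF) => //; exact: ltW.
  by rewrite (sg0_sym m F T sgF)// sg0E.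
(* This pairs [h f = h D - (T h v - v) + h (a v)] with [w]; by [E1] the middle bracket is one term
   of the telescoping sum. *)
have E2 : h * ip w f = h * ip w D - (ip w (T h v) - ip w v) + h * (a * ip w v).
  rewrite /D (psdDr ipsd)//; [|exact: (psd_domZ ipsd)|exact: (psd_domB ipsd)].
  rewrite (psdZr ipsd)// (psdBr ipsd _ _ _ LTv)// (psdBr ipsd _ _ _ Lf)// (psdZr ipsd)//.
  by field; rewrite gt_eqF.
have Nw : N w <= N f by exact: (sg0_contract m F T sgF).
have NB g : L2 m g -> ip w g <= N f * N g.
  move=> Lg; apply: le_trans (ler_norm _) _.
  apply: le_trans (psd_le_seminorm ipsd _ _ Lw Lg) _.
  by rewrite ler_wpM2r ?seminorm_ge0.
have B1 : h * ip w D <= h * (N f * N D) by rewrite ler_pM2l// NB.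
have B2 : h * (a * ip w v) <= h * (a * (N f * N v)) by rewrite !ler_pM2l// NB.
rewrite E1 E2; rewrite -natr1; move: IH; rewrite -/w.
lra.
Qed.

End SemigroupApproximation.

(** * A bound on the Riemann sums of [(T_t f, f)] that is uniform in the time horizon *)

Section RiemannBound.
Context {d : measure_display} {R : realType} {E : borelMetricType d R}.
Variables (m : {measure set E -> \bar R}) (F : qform E) (T : R -> (E -> R) -> (E -> R)).
Hypotheses (sf : Defs.symmetric_form m F) (cl : closed_form m F).
Hypothesis sgF : semigroup_of m F T.
Local Notation ip := (inner m).
Local Notation N := (seminorm (inner m)).
Local Notation ipsd := (inner_psd m).

(** Take [v = G_a f] in [sg_riemann_sum_le]: the hypothesis bounds the telescoped terms by 1, and
    the two error terms are made small by choosing first [a], then [h]. *)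
Lemma sg_riemann_sum_bounded f tau e : 0 < tau -> 0 < e -> L2 m f ->
  (forall a v, 0 < a -> is_resolvent m F a (a^-1 *: f) v ->
    ip f v <= 1 /\ forall t, 0 < t -> 0 <= ip (T t f) v) ->
  exists n : nat, let h := tau / n.+1%:R in
    h * \sum_(k < n.+1) ip (sg0 T (k%:R * h) f) f <= 1 + e.
Proof.
move=> tau0 e0 Lf Hf.
(* Each of the two errors will be at most [tau * (N f * b)], hence at most [e / 2]; the 1 covers the
   case [N f = 0]. *)
pose b := e / (2 * tau * (N f + 1)).
have Nf0 : 0 <= N f by exact: seminorm_ge0.
have b0 : 0 < b by rewrite divr_gt0// !mulr_gt0// ltr_wpDl.
have be : tau * (N f * b) <= e / 2.
  rewrite (_ : tau * _ = (e / 2) * (N f / (N f + 1))); last first.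
    by rewrite /b; field; rewrite !gt_eqF// ltr_wpDl.
  apply: ler_piMr; first by rewrite divr_ge0// ltW.
  by rewrite ler_pdivrMr ?ltr_wpDl// mul1r lerDl.
clearbody b.
(* From [a (v, v) <= (f, v) <= 1] follows [(a N v) ^+ 2 <= a], that is, [a N v <= b]. *)
pose a := b ^+ 2; have a0 : 0 < a by rewrite exprn_gt0.
have Laf := psd_domZ ipsd a^-1 _ Lf.
have [v rv] := resolvent_exists m F sf a (a^-1 *: f) a0 Laf cl.
have [fv1 Tfv0] := Hf _ _ a0 rv.
have Dv := rv.1; have Lv := dom_L2 m F sf _ Dv.
have aE : a *: (a^-1 *: f - v) = f - a *: v.
  by rewrite scalerBr scalerA divff ?gt_eqF// scale1r.
have aNv : a * N v <= b.
  rewrite -(@ler_pXn2r _ 2)// ?nnegrE ?mulr_ge0 ?seminorm_ge0 ?(ltW b0) ?(ltW a0)//.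
  rewrite exprMn (sqr_seminorm ipsd)// expr2 -mulrA -[leRHS]mulr1 -/a ler_pM2l//.
  apply: le_trans fv1; have := psd_ge0 _ _ (form_psd m F sf) _ Dv.
  rewrite rv.2// -(psdZl ipsd)//; last exact: (psd_domB ipsd).
  by rewrite aE (psdBl ipsd)// ?(psdZl ipsd)//; [lra|exact: (psd_domZ ipsd)].
have [del del0 H] := resolvent_generator_lt m F T sf sgF a _ v b Laf rv b0.
have [n _ /(_ n (leqnn n)) /= nP] := near_infty_natSinv_lt (PosNum (divr_gt0 del0 tau0)).
exists n => /=; set h := tau / _; have h0 : 0 < h by rewrite divr_gt0.
have hd : h < del by move: nP; rewrite ltr_pdivlMr// mulrC.
have nh : n.+1%:R * h = tau by rewrite /h mulrC divfK// pnatr_eq0.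
have {H} := ltW (H h h0 hd); rewrite aE => H.
have := sg_riemann_sum_le m F T sf sgF a f v n.+1 h a0 h0 Lf Dv.
move=> /le_trans; apply; rewrite nh sg0E//.
have h1 : tau * (a * N f * N v) <= tau * (N f * b).
  by rewrite ler_pM2l// -mulrA mulrCA ler_wpM2l.
have h2 : tau * (N f * N (h^-1 *: (T h v - v) + (f - a *: v))) <= tau * (N f * b).
  by rewrite ler_pM2l// ler_wpM2l.
have := Tfv0 _ tau0; lra.
Qed.

End RiemannBound.

(** * Positivity of the Schroedinger semigroup *)

Section SchroedingerPositivity.
Context {d : measure_display} {R : realType} {E : borelMetricType d R}.
Variables (m mu : {measure set E -> \bar R}) (F Fmu : qform E).

Lemma C0_bounded (u : E -> R) : C0 u -> exists2 c : R, 0 < c & forall x, `|u x| <= c.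
Proof.
move=> [cu Ku]; have /compact_bounded [M [_ HM]] : compact (u @` closure [set x | u x != 0]).
  by apply: continuous_compact => //; exact: continuous_subspaceT.
pose c := Num.max M 0 + 1.
have cM : M < c by rewrite /c ltr_pwDr// le_max lexx.
have c0 : 0 < c by rewrite /c ltr_pwDr// le_max lexx orbT.
exists c => // x; have [ux0|ux0] := eqVneq (u x) 0; first by rewrite ux0 normr0 ltW.
by apply: (HM _ cM); exists x => //; exact: subset_closure.
Qed.

Lemma C0_normr (u : E -> R) : C0 u -> C0 (fun x => `|u x|).
Proof.
move=> [cu Ku]; split.
  by move=> x; apply: continuous_comp; [exact: cu|exact: norm_continuous].
by rewrite (_ : [set x | _] = [set x | u x != 0])//; apply/seteqP; split => x /=; rewrite normr_eq0.
Qed.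

Hypothesis F_dirichlet : dirichlet_form m F.

Let sfF : Defs.symmetric_form m F. Proof. by case: F_dirichlet. Qed.
Local Notation fpsd := (form_psd m F sfF).

(** The unit contraction also truncates at 1, so it is applied to [u / c], where this truncation has
    no effect. *)
Lemma dom_pospart (u : E -> R) c : 0 < c -> (forall x, `|u x| <= c) -> dom F u ->
  let up := fun x => Num.max (u x) 0 in dom F up /\ F up up <= F u u.
Proof.
move=> c0 uc Du up; have [_ _ mF] := F_dirichlet.
have := mF _ (psd_domZ fpsd c^-1 _ Du).
have upE : up = c *: unit_contraction (c^-1 *: u).
  apply/funext => x; rewrite /up /unit_contraction /= -[RHS]/(c * _).
  rewrite -[(c^-1 *: u) x]/(c^-1 * u x).
  have h : c^-1 * u x <= 1.
    by rewrite mulrC ler_pdivrMr// mul1r (le_trans (ler_norm _)).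
  rewrite min_l; last by rewrite ge_max h ler01.
  by rewrite maxr_pMr ?ltW// mulrA divff ?gt_eqF// mul1r mulr0.
move=> [D1 F1]; rewrite upE; split; first exact: (psd_domZ fpsd).
rewrite (psd_sqrZ fpsd)//; apply: (@le_trans _ _ (c ^+ 2 * F (c^-1 *: u) (c^-1 *: u))).
  by rewrite ler_pM2l// exprn_gt0.
by rewrite (psd_sqrZ fpsd)// mulrA exprVn divff ?mul1r// gt_eqF// exprn_gt0.
Qed.

(** As [|u|] and [u] are the sum and the difference of [u^+] and [u^-], the energy inequality
    amounts to [F u^+ u^- <= 0]. *)
Lemma dom_normr (u : E -> R) : dom F u -> C0 u ->
  let au := fun x => `|u x| in dom F au /\ F au au <= F u u.
Proof.
move=> Du /C0_bounded[c c0 uc] au.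
pose up := fun x => Num.max (u x) 0; pose un := fun x => Num.max (- u x) 0.
have [Dup _] := dom_pospart u c c0 uc Du.
have [Dun _] : dom F un /\ F un un <= F (- u) (- u).
  apply: (dom_pospart (- u) c) => //; last exact: (psd_domN fpsd).
  by move=> x; rewrite -[(- u) x]/(- u x) normrN.
rewrite -/up in Dup.
have uE : u = up - un.
  apply/funext => x; rewrite -[RHS]/(Num.max (u x) 0 - Num.max (- u x) 0).
  have /orP[h|h] := le_total 0 (u x).
    by rewrite max_l// max_r ?subr0// oppr_le0.
  by rewrite max_r// max_l ?sub0r ?opprK// oppr_ge0.
have auE : au = up + un.
  apply/funext => x; rewrite -[RHS]/(Num.max (u x) 0 + Num.max (- u x) 0) /au.
  have /orP[h|h] := le_total 0 (u x).
    by rewrite ger0_norm// max_l// max_r ?addr0// oppr_le0.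
  by rewrite ler0_norm// max_r// max_l ?add0r// oppr_ge0.
(* [u^+] is also the positive part of [u^+ - s u^-]; compare the energies and
   let [s] tend to 0. *)
have key (s : R) : 0 < s -> 2 * F up un <= s * F un un.
  move=> s0; have Dw : dom F (up - s *: un).
    by apply: (psd_domB fpsd) => //; exact: (psd_domZ fpsd).
  have [] := dom_pospart (up - s *: un) (c + s * c) _ _ Dw; last first.
  - set w := (fun x => _); have -> : w = up.
      apply/funext => x; rewrite /w -[(up - _) x]/(Num.max (u x) 0 - s * Num.max (- u x) 0) /up.
      have /orP[h|h] := le_total 0 (u x).
        by rewrite [Num.max (- u x) 0]max_r ?oppr_le0// mulr0 subr0 -maxA maxxx.
      rewrite [Num.max (u x) 0]max_r// max_r// sub0r oppr_le0.
      by rewrite mulr_ge0 ?(ltW s0)// le_max lexx orbT.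
    move=> _; rewrite (psd_sqrB fpsd)//; last exact: (psd_domZ fpsd).
    rewrite (psd_sqrZ fpsd)// (psdZr fpsd)// => h.
    by rewrite -(ler_pM2l s0); lra.
  - move=> x; rewrite -[(up - _) x]/(Num.max (u x) 0 - s * Num.max (- u x) 0).
    have := uc x; rewrite ler_norml => /andP[h1 h2].
    apply: le_trans (ler_normB _ _) _; apply: lerD.
      by rewrite ger0_norm ?le_max ?lexx ?orbT// ge_max h2 ltW.
    rewrite normrM (gtr0_norm s0) ler_pM2l// ger0_norm ?le_max ?lexx ?orbT//.
    by rewrite ge_max (ltW c0) andbT; lra.
  - by rewrite addr_gt0// mulr_gt0.
have F0 : F up un <= 0.
  rewrite leNgt; apply/negP => Fp.
  have n0 := psd_ge0 _ _ fpsd _ Dun.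
  have s0 : 0 < F up un / (F un un + 1) by rewrite divr_gt0// ltr_wpDl.
  have := key _ s0; rewrite mulrAC ler_pdivlMr ?ltr_wpDl//.
  by nra.
rewrite auE; split; first exact: (psd_domD fpsd).
by rewrite uE (psd_sqrD fpsd)// (psd_sqrB fpsd)//; lra.
Qed.

Hypothesis Fmu_closure : closure_of m (schroedinger_form F mu) Fmu.
Let sfmu : Defs.symmetric_form m Fmu. Proof. by case: Fmu_closure. Qed.
Let clmu : closed_form m Fmu. Proof. by case: Fmu_closure. Qed.
Local Notation ip := (inner m).
Local Notation ipsd := (inner_psd m).

(** The first variation vanishes at [u], so the excess of the functional at [v] measures the
    distance from [v] to [u]. *)
Lemma resolvent_minimizer a f u v : 0 < a -> L2 m f -> is_resolvent m Fmu a f u -> dom Fmu v ->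
  resolvent_functional m Fmu a f v =
  resolvent_functional m Fmu a f u + shifted_form m Fmu a (v - u) (v - u).
Proof.
move=> a0 Lf [Du Fu] Dv; have Dw := psd_domB (form_psd m Fmu sfmu) _ _ Dv Du.
rewrite -{1}[v](subrKC u) resolvent_functionalD// {1}/shifted_form Fu//.
rewrite (psdBl ipsd)//; [ring|exact: (dom_L2 _ _ sfmu)..].
Qed.

(* On the core, replacing [v] by [|v|] decreases the functional that the
   resolvent minimises, so the minimiser is a limit of nonnegative functions. *)
Lemma resolvent_nneg a f u : 0 < a -> L2nneg m f -> is_resolvent m Fmu a f u ->
  L2nneg m u.
Proof.
move=> a0 [Lf f0] ru; have [_ _ dcore Fcore acore] := Fmu_closure.
have mpsd := form_psd m Fmu sfmu.
have bpsd := shifted_form_psd m Fmu sfmu a (ltW a0).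
have Du := ru.1; have Lu := dom_L2 m Fmu sfmu _ Du.
apply: L2nneg_closed => // e e0.
(* With this energy distance to the core, the shifted form of [u - v], and hence that of [|v| - u],
   is below [a * e ^+ 2]. *)
have eta0 : 0 < a * e ^+ 2 / (1 + a) by rewrite divr_gt0 ?addr_gt0 ?mulr_gt0 ?exprn_gt0.
have [v /[dup] cv [Dv Cv] uv] := acore u Du _ eta0.
have [Dav Fav] := dom_normr v Dv Cv.
pose av := fun x => `|v x|.
have cav : dom (schroedinger_form F mu) av by split => //; exact: C0_normr.
have Dmv := dcore _ cv; have Dmav := dcore _ cav.
have Lv := dom_L2 m Fmu sfmu _ Dmv; have Lav := dom_L2 m Fmu sfmu _ Dmav.
have avv (n : {measure set E -> \bar R}) : inner n av av = inner n v v.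
  by apply: eq_Rintegral => x _; rewrite /av -expr2 real_normK ?num_real.
have Fle : Fmu av av <= Fmu v v.
  rewrite !Fcore//= -/(inner mu av av) -/(inner mu v v) avv.
  by rewrite lerD2r.
have fle : ip f v <= ip f av.
  rewrite -subr_ge0 -(psdBr ipsd)//; apply: inner_ge0; split => //.
    exact: (psd_domB ipsd).
  by apply: aeW => x; rewrite -[(av - v) x]/(`|v x| - v x) subr_ge0 ler_norm.
have Jle : resolvent_functional m Fmu a f av <= resolvent_functional m Fmu a f v.
  rewrite /resolvent_functional /shifted_form avv.
  have : 2 * a * ip f v <= 2 * a * ip f av by rewrite ler_pM2l// mulr_gt0.
  lra.
rewrite (resolvent_minimizer a f u av)// (resolvent_minimizer a f u v)// lerD2l in Jle.
have Dw := psd_domB mpsd _ _ Dmav Du; have Dw' := psd_domB mpsd _ _ Du Dmv.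
exists av; first by split => //; apply: aeW => x; exact: normr_ge0.
rewrite (seminormBC ipsd)// (seminorm_lt ipsd)//; last exact: (psd_domB ipsd).
have : a * ip (av - u) (av - u) <= shifted_form m Fmu a (av - u) (av - u).
  by rewrite /shifted_form lerDr (psd_ge0 _ _ mpsd).
move=> /le_trans/(_ Jle); rewrite (psd_sqrBC bpsd)//.
move=> /le_trans/(_ (shifted_form_le_energy1 m Fmu sfmu _ _ a0 Dw')).
move: uv; rewrite ltr_pdivlMr ?addr_gt0// mulrC => uv /le_lt_trans/(_ uv).
by rewrite ltr_pM2l.
Qed.

Variable T : R -> (E -> R) -> (E -> R).
Hypothesis sgT : semigroup_of m Fmu T.

Lemma sg_nneg t f : 0 < t -> L2nneg m f -> L2nneg m (T t f).
Proof.
apply: (sg_cone m Fmu T sfmu clmu sgT); first by move=> u [].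
  by move=> u Lu; exact: L2nneg_closed.
exact: resolvent_nneg.
Qed.

End SchroedingerPositivity.

(** * Integration in time and space *)

Section SigmaFiniteTonelli.
Context {d : measure_display} {R : realType} {E : borelMetricType d R}.
Variable m : {measure set E -> \bar R}.
Local Notation leb := (@lebesgue_measure R).

Section Tonelli.
Hypothesis m_sf : sigma_finite setT m.
Variable f : R * E -> \bar R.
Hypotheses (mf : measurable_fun setT f) (f0 : forall z, (0 <= f z)%E).

(** [m] bundled with its sigma-finiteness, the form in which the Tonelli theorems take it. *)
Let m' : {sigma_finite_measure set E -> \bar R} :=
  SigmaFiniteMeasure.Pack (@SigmaFiniteMeasure.Class d E R m _ (Measure.class m)
    (isSFinite.Build _ _ _ _ (sfinite_measure_sigma_finite m_sf))
    (isSigmaFinite.Build _ _ _ (m : set E -> \bar R) m_sf)).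

Lemma time_space_tonelli :
  (\int[leb]_t \int[m]_x f (t, x) = \int[m]_x \int[leb]_t f (t, x))%E.
Proof. exact: (@fubini_tonelli _ _ _ _ R leb m' f mf f0). Qed.

Lemma measurable_space_integral : measurable_fun setT (fun t : R => \int[m]_x f (t, x))%E.
Proof. exact: (@measurable_fun_fubini_tonelli_F _ _ _ _ R m' f mf f0). Qed.

Lemma measurable_time_integral : measurable_fun setT (fun x => \int[leb]_t f (t, x))%E.
Proof. exact: (@measurable_fun_fubini_tonelli_G _ _ _ _ R leb f mf f0). Qed.

End Tonelli.

Lemma weight_measurable g : weight m g -> measurable_fun setT g.
Proof. by case=> /measurable_int/measurable_EFinP. Qed.

(** The sets [g >= 1 / n.+1] have finite measure by Markov's inequality; the null set [g <= 0] is
    added to each so that they cover the space. *)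
Lemma weight_sigma_finite g : weight m g -> sigma_finite setT m.
Proof.
move=> wg; have mg := weight_measurable _ wg; have [ig _ g0] := wg.
have mge c : measurable [set x | c <= g x].
  by rewrite -[X in measurable X]setTI; exact: measurable_fun_le.
have mle : measurable [set x | g x <= 0].
  by rewrite -[X in measurable X]setTI; exact: measurable_fun_le.
exists (fun n => [set x | g x <= 0] `|` [set x | n.+1%:R^-1 <= g x]).
  apply/seteqP; split => x // _ /=; have [h|h] := leP (g x) 0; first by exists 0%N => //; left.
  have [n _ /(_ n (leqnn n)) /= nP] := near_infty_natSinv_lt (PosNum h).
  by exists n => //; right; exact: ltW.
move=> n; have n0 : 0 < n.+1%:R^-1 :> R by rewrite invr_gt0.
split; first exact: measurableU.
set A := [set x | g x <= 0]; set B := [set x | _ <= g x].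
apply: (@le_lt_trans _ _ (m A + m B)%E); first exact: (measureU2 m mle (mge _)).
rewrite (_ : m A = 0)%E ?add0e; last first.
  apply/negligibleP => //; apply: negligibleS g0 => x /= h; apply/negP.
  by rewrite -leNgt.
have := le_integral_comp_abse m measurableT (f := id) (@measurable_id _ _ _) (fun r r0 => r0)
  (fun _ _ _ _ h => h) (measurable_int _ ig) n0.
rewrite setTI => /= h.
have : (n.+1%:R^-1%:E * m B < +oo)%E.
  apply: (le_lt_trans _ (integrableP _ _ _ ig).2).
  apply: le_trans h; apply: lee_pmul => //.
  apply: le_measure; rewrite ?inE; first exact: mge.
    have : measurable [set x | n.+1%:R^-1 <= `|g x|].
      by rewrite -[X in measurable X]setTI; apply: measurable_fun_le => //; exact: measurableT_comp.
    by [].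
  by move=> x /= h'; rewrite lee_fin (le_trans h') ?ler_norm.
have := measure_ge0 m B.
case: (m _) => [r _ _||//]; first exact: ltry.
by rewrite gt0_muley ?lte_fin.
Qed.

(** Boundedness and integrability combine in [g ^+ 2 <= |C| |g|]. *)
Lemma weight_L2 g : weight m g -> L2 m g.
Proof.
move=> wg; have mg := weight_measurable _ wg; have [ig [C gC] g0] := wg.
apply: L2P => //.
apply: (@le_lt_trans _ _ (\int[m]_x (`|C|%:E * `|(g x)%:E|))%E).
  apply: ge0_le_integral => //.
  - by move=> x _; rewrite lee_fin sqr_ge0.
  - by apply/measurable_EFinP/measurable_funX.
  - apply: measurable_funeM; apply: measurableT_comp => //; exact/measurable_EFinP.
  - move=> x _ /=; rewrite lee_fin -real_normK ?num_real// expr2 ler_wpM2r//.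
    exact: le_trans (gC x) (ler_norm _).
rewrite ge0_integralZl//; last by apply: measurableT_comp => //; exact/measurable_EFinP.
by rewrite lte_mul_pinfty ?lee_fin//; have /integrableP[] := ig.
Qed.

Lemma weight_nneg g : weight m g -> L2nneg m g.
Proof.
move=> wg; split; first exact: weight_L2.
by have [_ _] := wg; apply: filterS => x /ltW.
Qed.

End SigmaFiniteTonelli.

(** * Translation invariance of the Lebesgue integral *)

Section TimeTranslation.
Context {R : realType}.
Local Notation leb := (@lebesgue_measure R).

Let shift (t : R) (s : measurableTypeR R) : measurableTypeR R := s + t.

Let mshift t : measurable_fun setT (shift t).
Proof. exact: measurable_funD. Qed.

Lemma lebesgue_measure_translation (t : R) (A : set (measurableTypeR R)) :
  measurable A -> leb A = pushforward leb (shift t) A.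
Proof.
pose shiftm : {mfun measurableTypeR R >-> measurableTypeR R} :=
  HB.pack (shift t) (isMeasurableFun.Build _ _ _ _ (shift t) (mshift t)).
apply: (@lebesgue_measure_unique R (pushforward leb shiftm)) => _ [[a b] _ <-] /=.
rewrite /pushforward.
have -> : shift t @^-1` `]a, b] = `]a - t, b - t]%classic.
  by apply/seteqP; split => x /=; rewrite /shift !in_itv/= ltrBlDr lerBrDr.
rewrite !lebesgue_measure_itv /= !lte_fin ltrD2r; case: ifP => // _.
by rewrite -!EFinB; congr EFin; ring.
Qed.

Lemma ge0_integral_translation (t : R) (f : R -> \bar R) :
  measurable_fun setT f -> (forall s, (0 <= f s)%E) ->
  (\int[leb]_s f (s + t)%R = \int[leb]_s f s)%E.
Proof.
move=> mf f0; pose shiftm : {mfun measurableTypeR R >-> measurableTypeR R} :=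
  HB.pack (shift t) (isMeasurableFun.Build _ _ _ _ (shift t) (mshift t)).
rewrite [RHS](eq_measure_integral (pushforward leb shiftm)); last first.
  by move=> A mA _; exact: lebesgue_measure_translation.
by rewrite (ge0_integral_pushforward (mshift t))// => s _; exact: f0.
Qed.

End TimeTranslation.

(** * A nonnegative space-time density of the potential *)

Section PotentialDensity.
Context {d : measure_display} {R : realType} {E : borelMetricType d R}.
Variables (m : {measure set E -> \bar R}) (T : R -> (E -> R) -> (E -> R)) (g : E -> R).
Hypothesis m_sf : sigma_finite setT m.
Local Notation leb := (@lebesgue_measure R).
Local Notation ip := (inner m).

Lemma measurable_positive_times (p : R -> E -> R) :
  measurable_fun setT (fun z : R * E => p z.1 z.2) ->
  measurable_fun setT (fun z : R * E => \1_(`]0, +oo[ : set R) z.1 * Num.max (p z.1 z.2) 0).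
Proof.
move=> mp; apply: measurable_funM; last exact: measurable_maxr.
by apply: measurableT_comp => //; exact: measurable_indic.
Qed.

Lemma integral_positive_times (f : R -> R) :
  (\int[leb]_t (\1_(`]0, +oo[ : set R) t * f t)%:E =
   \int[leb]_(t in `]0%R, +oo[) (f t)%:E)%E.
Proof.
rewrite [RHS]integral_mkcond; apply: eq_integral => t _.
by rewrite /patch indicE; case: ifPn; rewrite ?mul1r ?mul0r.
Qed.

(** A version of [T_t g] that is nonnegative everywhere and zero for [t <= 0], so that Tonelli and
    translation apply to integrals over the whole time line. *)
Record potential_density (q : R * E -> R) (G : E -> \bar R) : Prop := {
  pd_measurable : measurable_fun setT q ;
  pd_ge0 : forall z, 0 <= q z ;
  pd_neg_time : forall t x, t <= 0 -> q (t, x) = 0 ;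
  pd_semigroup : forall t, 0 < t -> T t g = (fun x => q (t, x)) %[ae m] ;
  pd_integral : \forall x \ae m, G x = (\int[leb]_t (q (t, x))%:E)%E }.

(** [q] is the positive part of the given version at positive times. The negative part [r] has no
    effect on the time integrals: as [T_t g >= 0] a.e. for each [t], Tonelli makes its time integral
    vanish for almost every [x]. *)
Lemma potential_density_exists G : potential_of m T g G ->
  (forall t : R, 0 < t -> \forall x \ae m, 0 <= T t g x) ->
  exists q, potential_density q G.
Proof.
move=> [p [mp Tp Gp]] T0.
pose D : set R := `]0, +oo[%classic.
have D0 t : t <= 0 -> \1_D t = 0 :> R.
  move=> t0; rewrite indicE memNset//; apply/negP.
  by rewrite /D /= in_itv/= andbT -leNgt.
have D1 t : 0 < t -> \1_D t = 1 :> R.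
  by move=> t0; rewrite indicE mem_set//= /D /= in_itv/= andbT.
pose q z := \1_D z.1 * Num.max (p z.1 z.2) 0.
pose r (z : R * E) : R := \1_D z.1 * Num.max (- p z.1 z.2) 0.
have mq : measurable_fun setT q by exact: measurable_positive_times.
have mr : measurable_fun setT r.
  by apply: (measurable_positive_times (fun t x => - p t x)); exact: measurableT_comp.
have mrE : measurable_fun setT (EFin \o r) by exact/measurable_EFinP.
have r0 z : (0 <= (EFin \o r) z)%E.
  by rewrite lee_fin mulr_ge0// le_max lexx orbT.
have r_null : \forall x \ae m, (\int[leb]_t (r (t, x))%:E = 0)%E.
  have mI := measurable_time_integral (EFin \o r) mrE r0.
  have I0 x : (0 <= \int[leb]_t (EFin \o r) (t, x))%E by exact: integral_ge0.
  have : (\int[m]_x `|\int[leb]_t (EFin \o r) (t, x)| = 0)%E.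
    under eq_integral do rewrite gee0_abs//.
    rewrite -(time_space_tonelli m m_sf _ mrE r0).
    apply: integral0_eq => t _.
    have mrt : measurable_fun setT (fun x => (EFin \o r) (t, x)).
      exact: (measurableT_comp mrE (measurable_pair1 _)).
    rewrite (ae_eq_integral (cst 0%E))// ?integral0//.
    have [t0|t0] := leP t 0.
      by apply: aeW => x _; rewrite /r /= D0// mul0r.
    apply: filterS2 (Tp t t0) (T0 t t0) => x /(_ Logic.I) e h _.
    by rewrite /r /= -e max_r ?mulr0// oppr_le0.
  move=> /(ae_eq_integral_abs m measurableT mI).
  by apply: filterS => x /(_ Logic.I).
exists q; split => //.
- by move=> z; rewrite mulr_ge0// le_max lexx orbT.
- by move=> t x t0; rewrite /q /= D0// mul0r.
- move=> t t0; apply: filterS2 (Tp t t0) (T0 t t0) => x /(_ Logic.I) e h _.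
  by rewrite /q /= D1// mul1r -e max_l.
- apply: filterS2 Gp r_null => x -> rx.
  have {}rx : (\int[leb]_(t in `]0%R, +oo[) (Num.max (- p t x) 0)%:E = 0)%E.
    by rewrite -(integral_positive_times (fun t => Num.max (- p t x) 0)).
  rewrite integralE.
  rewrite (_ : \int[_]_(_ in _) _^\- _ = 0)%E; last first.
    by rewrite -[RHS]rx; apply: eq_integral => t _; rewrite funenegE -EFinN -EFin_max.
  rewrite sube0 /q (integral_positive_times (fun t => Num.max (p t x) 0)).
  by apply: eq_integral => t _; rewrite funeposE -EFin_max.
Qed.

Variables (q : R * E -> R) (G : E -> \bar R).
Hypothesis qG : potential_density q G.
Let mq := pd_measurable _ _ qG.
Let q0 := pd_ge0 _ _ qG.

Definition potential_version (x : E) : \bar R := (\int[leb]_t (q (t, x))%:E)%E.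

Lemma potential_version_ge0 x : (0 <= potential_version x)%E.
Proof. by apply: integral_ge0 => t _; rewrite lee_fin. Qed.

Lemma measurable_potential_version : measurable_fun setT potential_version.
Proof.
apply: (measurable_time_integral (EFin \o q)); first exact/measurable_EFinP.
by move=> z; rewrite lee_fin.
Qed.

(** For [t > 0] this is [(T_t g, phi)]; the integral of the density makes it nonnegative and
    measurable in [t]. *)
Definition potential_flux (phi : E -> R) (t : R) : \bar R :=
  (\int[m]_x (q (t, x) * phi x)%:E)%E.

Section Flux.
Variable phi : E -> R.
Hypotheses (mphi : measurable_fun setT phi) (phi0 : forall x, 0 <= phi x).

Let mqphi : measurable_fun setT (fun z : R * E => (q z * phi z.2)%:E).
Proof.
apply/measurable_EFinP; apply: measurable_funM => //.
exact: measurableT_comp.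
Qed.

Let qphi0 z : (0 <= (q z * phi z.2)%:E)%E.
Proof. by rewrite lee_fin mulr_ge0. Qed.

Lemma measurable_potential_flux : measurable_fun setT (potential_flux phi).
Proof. exact: (measurable_space_integral m m_sf _ mqphi qphi0). Qed.

Lemma potential_flux_ge0 t : (0 <= potential_flux phi t)%E.
Proof. by apply: integral_ge0 => x _; exact: (qphi0 (t, x)). Qed.

(** By Tonelli, integrals of the potential in space become integrals of [(T_t g, phi)] in time. *)
Lemma integral_potential_flux :
  (\int[m]_x (potential_version x * (phi x)%:E) = \int[leb]_t potential_flux phi t)%E.
Proof.
rewrite /potential_flux (time_space_tonelli m m_sf _ mqphi qphi0).
apply: eq_integral => x _; rewrite /potential_version -ge0_integralZr//.
- apply/measurable_EFinP; exact: (measurableT_comp mq (measurable_pair2 _)).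
- by move=> t _; rewrite lee_fin.
- by rewrite lee_fin.
Qed.

Lemma potential_flux_neg_time t : t <= 0 -> potential_flux phi t = 0%E.
Proof.
move=> t0; apply: integral0_eq => x _.
by rewrite (pd_neg_time _ _ qG)// mul0r.
Qed.

Lemma potential_fluxE t : 0 < t -> L2 m (T t g) -> L2 m phi ->
  potential_flux phi t = (ip (T t g) phi)%:E.
Proof.
move=> t0 LT Lphi; rewrite inner_EFin//; apply: ae_eq_integral => //.
- exact: (measurableT_comp mqphi (measurable_pair1 _)).
- by apply/measurable_EFinP; apply: measurable_funM => //; exact: L2_measurable LT.
- by apply: filterS (pd_semigroup _ _ qG _ t0) => x /(_ Logic.I) -> _.
Qed.

End Flux.

End PotentialDensity.

(** * The potential *)

Section Potential.
Context {d : measure_display} {R : realType} {E : borelMetricType d R}.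
Variables (m : {measure set E -> \bar R}) (F : qform E) (T : R -> (E -> R) -> (E -> R)).
Variables (g : E -> R) (q : R * E -> R) (G : E -> \bar R).
Hypotheses (sf : Defs.symmetric_form m F) (cl : closed_form m F).
Hypothesis sgF : semigroup_of m F T.
Hypothesis T_nneg : forall t f, 0 < t -> L2nneg m f -> L2nneg m (T t f).
Hypothesis wg : weight m g.
Hypothesis qG : potential_density m T g q G.
Local Notation leb := (@lebesgue_measure R).
Local Notation ip := (inner m).
Local Notation N := (seminorm (inner m)).
Local Notation ipsd := (inner_psd m).
Local Notation sg := sgF.1.
Local Notation S := (sg0 T).
Local Notation SL2 := (sg0_L2 m F T sgF).
Local Notation H := (potential_version q).
Local Notation flux := (potential_flux m q).
Let m_sf := weight_sigma_finite m g wg.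
Let Lg := weight_L2 m g wg.
(** [g] is positive only almost everywhere; [ag] is a version that is nonnegative everywhere. *)
Let ag := fun x => `|g x|.
Let Lag : L2 m ag. Proof. exact: L2_normr. Qed.
Let mag : measurable_fun setT ag. Proof. exact: L2_measurable Lag. Qed.
Let ag0 x : 0 <= ag x. Proof. exact: normr_ge0. Qed.
Let agE : ag = g %[ae m].
Proof. by have [_ _] := wg; apply: filterS => x h _; rewrite /ag gtr0_norm. Qed.

Lemma sg_inner_sqr f t : 0 <= t -> L2 m f -> ip (S (t + t) f) f = ip (S t f) (S t f).
Proof.
move=> t0 Lf; have LS := SL2 t _ Lf.
rewrite (inner_ae m _ (S t (S t f)))//; [|exact: SL2..|exact: (sg0_add m F T sgF)].
by rewrite (sg0_sym m F T sgF).
Qed.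

(** [(T_t f, f)] is the squared norm of [T_(t/2) f], and the semigroup is a contraction. *)
Lemma sg_inner_antitone f s t : 0 <= s -> s <= t -> L2 m f ->
  ip (S t f) f <= ip (S s f) f.
Proof.
move=> s0 st Lf; have t0 := le_trans s0 st.
have half (r : R) : r = r / 2 + r / 2 by lra.
rewrite (half t) (half s) !sg_inner_sqr ?divr_ge0//.
have LS := SL2 (s / 2) _ Lf.
rewrite -!(sqr_seminorm ipsd); [|exact: SL2..].
rewrite lerXn2r ?nnegrE ?seminorm_ge0//.
have d0 : 0 <= (t - s) / 2 by rewrite divr_ge0// subr_ge0.
have e : S (t / 2) f = S ((t - s) / 2) (S (s / 2) f) %[ae m].
  have -> : t / 2 = (t - s) / 2 + s / 2 by lra.
  by apply: (sg0_add m F T sgF) => //; rewrite divr_ge0.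
apply: le_trans (sg0_contract m F T sgF ((t - s) / 2) _ LS).
by rewrite /seminorm -[X in Num.sqrt X <= _]/(L2sq m _) (L2sq_ae m _ _ _ _ e)//; do ?apply: SL2.
Qed.

Lemma flux_fluxE (phi : E -> R) t : 0 < t -> L2 m phi -> flux phi t = (ip (T t g) phi)%:E.
Proof.
move=> t0 Lphi; apply: (potential_fluxE m T g q G qG) => //.
  exact: L2_measurable Lphi.
exact: (sg_L2 sg).
Qed.

Lemma flux_weightE t : 0 < t -> flux ag t = (ip (S t g) g)%:E.
Proof.
move=> t0; rewrite flux_fluxE// sg0E//; congr EFin.
have LT := sg_L2 sg t0 Lg.
rewrite (psd_sym _ _ ipsd)// [RHS](psd_sym _ _ ipsd)//.
exact: inner_ae.
Qed.

Let mflux (phi : E -> R) : measurable_fun setT phi -> (forall x, 0 <= phi x) ->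
  measurable_fun setT (flux phi).
Proof. exact: (measurable_potential_flux m T g m_sf q G qG). Qed.

(** The flux of [|g|] decreases in time, so the sum over left endpoints bounds the integral from
    above. *)
Lemma integral_flux_riemann (n : nat) (h : R) : 0 < h ->
  (\int[leb]_(t in `]0%R, (n%:R * h)%R]) flux ag t <=
   (h * \sum_(k < n) ip (S (k%:R * h) g) g)%:E)%E.
Proof.
move=> h0; have flux0 := potential_flux_ge0 m T g q G qG ag ag0.
have mf : measurable_fun setT (flux ag) by exact: mflux.
elim: n => [|n IH].
  by rewrite mul0r set_itvoc0 integral_set0 big_ord0 mulr0.
have nh0 : 0 <= n%:R * h by rewrite mulr_ge0// ltW.
have nnh : n%:R * h <= n.+1%:R * h by rewrite ler_pM2r// ler_nat.
rewrite (@itv_bndbnd_setU _ _ _ (BRight (n%:R * h)))//.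
rewrite ge0_integral_setU//=; last 2 first.
  exact: measurable_funTS.
  apply/disj_setPS => x [/=]; rewrite !in_itv/= => /andP[_ a] /andP[b _].
  by move: (le_lt_trans a b); rewrite ltxx.
rewrite big_ord_recr /= mulrDr EFinD; apply: leeD => //.
apply: (@le_trans _ _ (\int[leb]_(t in `](n%:R * h)%R, (n.+1%:R * h)%R])
    (ip (S (n%:R * h)%R g) g)%:E)%E).
  apply: ge0_le_integral => //.
  - exact: measurable_funTS.
  - move=> t /=; rewrite in_itv/= => /andP[nt tn].
    have t0 := le_lt_trans nh0 nt.
    by rewrite flux_weightE// lee_fin sg_inner_antitone// ltW.
rewrite integral_cst//= lebesgue_measure_itv /= lte_fin ltr_pM2r// ltr_nat ltnSn.
by rewrite -EFinB -EFinM lee_fin -natr1 mulrDl mul1r addrC addKr mulrC.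
Qed.

Section Finiteness.
(** Here [v = G_a g]; the first bound is where subcriticality enters. *)
Hypothesis g_resolvent : forall (a : R) (v : E -> R), 0 < a -> is_resolvent m F a (a^-1 *: g) v ->
  ip g v <= 1 /\ forall t : R, 0 < t -> 0 <= ip (T t g) v.

(** The bound is [1 + e] with [e = 1]; what matters is that it does not depend on [tau]. *)
Lemma integral_flux_le tau : 0 < tau ->
  (\int[leb]_(t in `]0%R, tau]) flux ag t <= 2%:E)%E.
Proof.
move=> tau0; have [n] := sg_riemann_sum_bounded m F T sf cl sgF g tau 1 tau0 ltr01 Lg g_resolvent.
set h := tau / _ => hn; have h0 : 0 < h by rewrite divr_gt0.
have := integral_flux_riemann n.+1 h h0.
have -> : n.+1%:R * h = tau by rewrite /h mulrC divfK// pnatr_eq0.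
move=> /le_trans; apply; rewrite lee_fin; apply: le_trans hn _.
by [].
Qed.

Lemma integral_flux_lty : (\int[leb]_t flux ag t < +oo)%E.
Proof.
have mf : measurable_fun setT (flux ag) by exact: mflux.
have f0 := potential_flux_ge0 m T g q G qG ag ag0.
(* These sets exhaust the line; starting them at [-oo] adds nothing, because the flux vanishes at
   nonpositive times. *)
pose I (n : nat) : set (measurableTypeR R) := `]-oo, n%:R]%classic.
have I_nd : nondecreasing_seq I.
  move=> a b ab; apply/subsetPset => x; rewrite /I /= !in_itv/= => /le_trans; apply.
  by rewrite ler_nat.
have UI : \bigcup_n I n = setT.
  apply/seteqP; split => // x _; exists (Num.bound `|x|) => //=.
  by rewrite /I /= in_itv/= (le_trans (ler_norm _))// ltW// archi_boundP.
have := @ge0_nondecreasing_set_cvg_integral _ _ R I (flux ag) leb I_nd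
  (fun n => measurable_itv _) (fun n => measurable_funTS mf) (fun n x _ => f0 x).
rewrite UI => cv; apply: (@le_lt_trans _ _ 2%:E%E); last exact: ltry.
rewrite -(cvg_lim _ cv)//; apply: lime_le; first exact: cvgP cv.
apply: nearW => n; have [n0|n0] := posnP n.
  rewrite integral0_eq// => t; rewrite /I /= in_itv/= n0 => t0.
  by rewrite (potential_flux_neg_time m T g q G qG).
apply: le_trans (integral_flux_le n%:R _); last by rewrite ltr0n.
rewrite le_eqVlt; apply/orP; left; apply/eqP.
rewrite [LHS]integral_mkcond [RHS]integral_mkcond; apply: eq_integral => t _.
rewrite /patch; have [t0|t0] := ltP 0 t.
  by congr (if _ then _ else _); apply/idP/idP; rewrite !inE /I /= !in_itv/= t0.
by rewrite (potential_flux_neg_time m T g q G qG)//; do 2 case: ifP.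
Qed.

Lemma potential_version_lty : \forall x \ae m, (H x < +oo)%E.
Proof.
have H0 := potential_version_ge0 m T g q G qG.
have mH := measurable_potential_version m T g q G qG.
have mHg : measurable_fun setT (fun x => H x * (ag x)%:E)%E.
  by apply: emeasurable_funM => //; exact/measurable_EFinP.
have : m.-integrable setT (fun x => H x * (ag x)%:E)%E.
  apply/integrableP; split => //.
  under eq_integral do rewrite gee0_abs ?mule_ge0 ?lee_fin//.
  by rewrite (integral_potential_flux m T g m_sf q G qG)//; exact: integral_flux_lty.
move=> /(integrable_ae measurableT); have [_ _ g0] := wg.
apply: filterS2 g0 => x gx /(_ Logic.I).
rewrite /ag gtr0_norm//; have := H0 x; case: (H x) => [r _ _|_|//]; first exact: ltry.
by rewrite gt0_mulye.
Qed.

End Finiteness.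

(* Otherwise [T_t g] would vanish on [H = 0] for almost every [t], and so would
   its limit [g] as [t] tends to 0. *)
Lemma potential_version_gt0 : \forall x \ae m, (0 < H x)%E.
Proof.
have H0 := potential_version_ge0 m T g q G qG.
have mH := measurable_potential_version m T g q G qG.
pose A := [set x | H x = 0%E].
have mA : measurable A.
  by rewrite -[X in measurable X]setTI; exact: (mH _ _ (emeasurable_set1 _)).
(* For this [phi], [(g, phi) = (phi, phi)], so once [(g, phi) = 0] the set where [H = 0] is null. *)
pose phi x := ag x * \1_A x.
have mphi : measurable_fun setT phi by apply: measurable_funM => //; exact: measurable_indic.
have phi0 x : 0 <= phi x by rewrite mulr_ge0.
have Lphi : L2 m phi.
  apply: (le_L2 m phi ag) => //; apply: aeW => x.
  by rewrite /phi normrM [`|\1_A x|]ger0_norm// ler_piMr// indicE; case: (_ \in _).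
have : (\int[leb]_t `|flux phi t| = 0)%E.
  have f0 := potential_flux_ge0 m T g q G qG phi phi0.
  under eq_integral do rewrite gee0_abs//.
  rewrite -(integral_potential_flux m T g m_sf q G qG)//.
  apply: integral0_eq => x _; rewrite /phi indicE; have [/set_mem ->|_] := boolP (x \in A).
    by rewrite mul0e.
  by rewrite mulr0 mule0.
move=> /(ae_eq_integral_abs leb measurableT (mflux _ mphi phi0)) flux_ae.
have gphi : ip g phi = 0.
  apply/eqP; rewrite -normr_eq0 eq_le normr_ge0 andbT; apply/ler_addgt0Pr => e e0.
  rewrite add0r; have Np : 0 < N phi + 1 by rewrite ltr_wpDl ?seminorm_ge0.
  have e'0 : 0 < e / (N phi + 1) by rewrite divr_gt0.
  have e'20 : 0 < (e / (N phi + 1)) ^+ 2 by rewrite exprn_gt0.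
  have /cvgr0Pnorm_lt/(_ _ e'20)/at_right0_lt[del del0 Hd] := sg_cont sg Lg.
  (* The flux vanishes for almost every time and []0, del[] has positive length. *)
  have [t [t0 td ft]] : exists t, [/\ 0 < t, t < del & flux phi t = 0%E].
    apply: contrapT => Hn; have [Z [mZ Z0 HZ]] := flux_ae.
    have : (leb `]0%R, del[ <= leb Z)%E.
      apply: le_measure; rewrite ?inE// => t /=; rewrite in_itv/= => /andP[t0 td].
      by apply: HZ => /= h; apply: Hn; exists t; split => //; exact: h.
    by rewrite Z0 lebesgue_measure_itv/= lte_fin del0 sube0 lee_fin leNgt del0.
  have LT := sg_L2 sg t0 Lg; have LTg := psd_domB ipsd _ _ LT Lg.
  have Tphi : ip (T t g) phi = 0 by apply: EFin_inj; rewrite -flux_fluxE.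
  have : `|ip (T t g - g) phi| <= e.
    apply: le_trans (psd_le_seminorm ipsd _ _ LTg Lphi) _.
    have hN : N (T t g - g) <= e / (N phi + 1).
      by rewrite ltW// (seminorm_lt ipsd)// (le_lt_trans (ler_norm _)) ?Hd.
    apply: le_trans (ler_wpM2r (seminorm_ge0 _) hN) _.
    by rewrite mulrAC ler_pdivrMr// ler_pM2l// lerDl.
  by rewrite (psdBl ipsd)// Tphi sub0r normrN.
have phi_sq : L2sq m phi = 0.
  rewrite -gphi -(inner_ae m ag g phi)//; apply: eq_Rintegral => x _.
  by rewrite /phi indicE; case: (_ \in _); rewrite ?mulr1 ?mulr0 ?mul0r.
have [_ _ g0] := wg.
apply: filterS2 g0 (L2sq0_ae m phi Lphi phi_sq) => x gx /(_ Logic.I) px.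
rewrite lt_neqAle H0 andbT; apply/eqP => /esym Hx.
move: px; rewrite /phi indicE mem_set// mulr1 /ag => /eqP.
by rewrite normr_eq0 gt_eqF.
Qed.

(** By symmetry [(T_t f, phi) = (f, T_t phi) <= int H T_t phi dm]. The flux of [T_t phi] at time
    [s > 0] is that of [phi] at time [s + t], so translation in time gives the bound. *)
Lemma inner_sg_le_potential f phi t : 0 < t -> L2nneg m f ->
  (\forall x \ae m, ((f x)%:E <= H x)%E) -> L2 m phi -> (forall x, 0 <= phi x) ->
  ((ip (T t f) phi)%:E <= \int[m]_x (H x * (phi x)%:E))%E.
Proof.
move=> t0 [Lf f0] fH Lphi phi0.
have mphi := L2_measurable m phi Lphi.
have mH := measurable_potential_version m T g q G qG.
have phin : L2nneg m phi by split => //; exact: aeW.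
have [LTphi Tphi0] := T_nneg t phi t0 phin.
pose psi x := `|T t phi x|.
have Lpsi : L2 m psi by exact: L2_normr.
have mpsi := L2_measurable m psi Lpsi.
have psi0 x : 0 <= psi x by exact: normr_ge0.
have psiE : T t phi = psi %[ae m] by apply: filterS Tphi0 => x h _; rewrite /psi ger0_norm.
pose af x := `|f x|; have Laf : L2 m af by exact: L2_normr.
have -> : ip (T t f) phi = ip af psi.
  rewrite (sg_sym sg)// (psd_sym _ _ ipsd)// (inner_ae m _ psi)// (psd_sym _ _ ipsd)//.
  apply: inner_ae => //; apply: filterS f0 => x h _; rewrite /af ger0_norm//.
rewrite inner_EFin//; apply: (@le_trans _ _ (\int[m]_x (H x * (psi x)%:E))%E).
  apply: ae_ge0_le_integral => //.
  - by move=> x _; rewrite lee_fin mulr_ge0// normr_ge0.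
  - apply/measurable_EFinP; apply: measurable_funM => //; exact: L2_measurable Laf.
  - by move=> x _; rewrite mule_ge0 ?lee_fin//; exact: (potential_version_ge0 m T g q G qG).
  - by apply: emeasurable_funM => //; exact/measurable_EFinP.
  - apply: filterS2 f0 fH => x fx0 fx _; rewrite EFinM lee_wpmul2r ?lee_fin//.
    by rewrite /af ger0_norm.
rewrite !(integral_potential_flux m T g m_sf q G qG)//.
rewrite -(ge0_integral_translation t (flux phi))//; last 2 first.
- exact: mflux.
- exact: (potential_flux_ge0 m T g q G qG).
apply: ge0_le_integral => //.
- by move=> s _; exact: (potential_flux_ge0 m T g q G qG).
- exact: mflux.
- have ms : measurable_fun setT (fun s : measurableTypeR R => s + t : measurableTypeR R).
    exact: measurable_funD.
  exact: (measurableT_comp (mflux _ mphi phi0) ms).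
(* For [s > 0] the two sides agree; for [s <= 0] the left one is 0, which is where the inequality is
   lost. *)
- move=> s _; have [s0|s0] := leP s 0.
    rewrite (potential_flux_neg_time m T g q G qG)//.
    exact: (potential_flux_ge0 m T g q G qG).
  have LT := sg_L2 sg s0 Lg; have st0 : 0 < t + s by rewrite addr_gt0.
  rewrite !flux_fluxE ?[s + t]addrC// lee_fin.
  rewrite (psd_sym _ _ ipsd)// -(inner_ae m (T t phi))// (psd_sym _ _ ipsd)//.
  rewrite -(sg_sym sg)// -(inner_ae m (T (t + s) g))//.
  - exact: (sg_L2 sg).
  - exact: (sg_L2 sg).
  - exact: (sg_add sg).
Qed.

(** The tested inequality is localised to the set [B] where the claim fails: with [phi = |g| 1_B],
    the function [(T_t f - H) phi] is nonnegative and its integral is at most 0. Since [g > 0] a.e.,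
    [B] is null. *)
Lemma sg_le_potential f t : 0 < t -> L2nneg m f ->
  (\forall x \ae m, ((f x)%:E <= H x)%E) -> \forall x \ae m, ((T t f x)%:E <= H x)%E.
Proof.
move=> t0 nf fH; have [Lf f0] := nf.
have H0 := potential_version_ge0 m T g q G qG.
have mH := measurable_potential_version m T g q G qG.
have LT := sg_L2 sg t0 Lf; have mT := L2_measurable m _ LT.
pose B := [set x | (H x < (T t f x)%:E)%E].
have mB : measurable B.
  rewrite -[X in measurable X]setTI; apply: emeasurable_fun_lt => //; exact/measurable_EFinP.
pose phi x := ag x * \1_B x.
have mphi : measurable_fun setT phi by apply: measurable_funM => //; exact: measurable_indic.
have phi0 x : 0 <= phi x by rewrite mulr_ge0.
have Lphi : L2 m phi.
  apply: (le_L2 m phi ag) => //; apply: aeW => x.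
  by rewrite /phi normrM [`|\1_B x|]ger0_norm// ler_piMr// indicE; case: (_ \in _).
have iT := L2_integrable m _ _ LT Lphi.
have HT x : (H x * (phi x)%:E <= (T t f x * phi x)%:E)%E.
  rewrite /phi indicE; have [/set_mem Bx|_] := boolP (x \in B); last by rewrite !mulr0 mule0.
  by rewrite mulr1 EFinM lee_wpmul2r ?lee_fin// ltW.
have Hphi0 x : (0 <= H x * (phi x)%:E)%E by rewrite mule_ge0 ?lee_fin.
have mHphi : measurable_fun setT (fun x => H x * (phi x)%:E)%E.
  by apply: emeasurable_funM => //; exact/measurable_EFinP.
(* [H phi] is dominated by the integrable [T_t f phi], so the integral of the difference can be
   split. *)
have iH : m.-integrable setT (fun x => H x * (phi x)%:E)%E.
  apply: (le_integrable measurableT mHphi _ iT) => x _ /=.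
  by rewrite gee0_abs// (le_trans (HT x))// lee_fin ler_norm.
have := inner_sg_le_potential f phi t t0 nf fH Lphi phi0.
rewrite inner_EFin// => le_int.
pose D x := ((T t f x * phi x)%:E - H x * (phi x)%:E)%E.
have D0 x : (0 <= D x)%E by rewrite /D sube_ge0 ?orbT//; exact: HT.
have mD : measurable_fun setT D.
  by apply: emeasurable_funB => //; exact: (measurable_int _ iT).
have : (\int[m]_x `|D x| = 0)%E.
  under eq_integral do rewrite gee0_abs//.
  apply/eqP; rewrite eq_le integral_ge0// andbT /D integralB//.
  by rewrite sube_le0.
move=> /(ae_eq_integral_abs m measurableT mD); have [_ _ g0] := wg.
apply: filterS2 g0 => x gx /(_ Logic.I); rewrite leNgt => Dx; apply/negP => Bx.
have xB : x \in B by exact/mem_set.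
move: Dx (H0 x) Bx; rewrite /D /phi indicE xB mulr1 /ag gtr0_norm//.
case: (H x) => [r||//] /=; last by move=> _ _; rewrite ltNge leey.
move=> -[] /eqP. rewrite -mulrBl mulf_eq0 (gt_eqF gx) orbF subr_eq0.
by move=> /eqP -> _; rewrite ltxx.
Qed.

End Potential.

(** * The h-transform *)

Section WeightedMeasure.
Context {d : measure_display} {R : realType} {E : borelMetricType d R}.
Variables (m : {measure set E -> \bar R}) (h : {mfun E >-> \bar R}).
Local Notation wm := (weighted_measure m h).
Let w x := fine (h x) ^+ 2.

Let w0 x : 0 <= w x. Proof. exact: sqr_ge0. Qed.

Lemma measurable_fine_mfun : measurable_fun setT (fun x => fine (h x)).
Proof. exact: measurableT_comp. Qed.

Let mw : measurable_fun setT w.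
Proof. by apply: measurable_funX; exact: measurable_fine_mfun. Qed.

Import HBNNSimple.

Let nnsfun_weighted (f : {nnsfun E >-> R}) :
  (\int[wm]_x (f x)%:E = \int[m]_x ((f x)%:E * (w x)%:E))%E.
Proof.
transitivity (\int[wm]_x (\sum_(y \in range f) (y * \1_(f @^-1` [set y]) x)%:E))%E.
  by apply: eq_integral => t tE; rewrite /= fimfunE -fsumEFin.
have indich r : measurable_fun setT (fun x => (r * \1_(f @^-1` [set r]) x)%:E).
  by apply: (measurable_comp measurableT) => //; exact: measurable_funM.
rewrite ge0_integral_fsum//; last by move=> y x _; exact: nnfun_muleindic_ge0.
transitivity (\int[m]_x (\sum_(y \in range f)
    (y * \1_(f @^-1` [set y]) x)%:E * (w x)%:E))%E; last first.
  under [RHS]eq_integral => x xE.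
    rewrite fimfunE -fsumEFin// ge0_mule_fsuml; last by move=> y; exact: nnfun_muleindic_ge0.
    over.
  by [].
rewrite ge0_integral_fsum//; last 2 first.
  - by move=> y; apply: emeasurable_funM => //; exact/measurable_EFinP.
  - by move=> y x _; apply: mule_ge0; [exact: nnfun_muleindic_ge0|rewrite lee_fin].
apply: eq_fsbigr => r /set_mem[x0 _ <-]; set c := f x0.
have c0 : (0 <= c%:E)%E by rewrite lee_fin.
have mA : measurable (f @^-1` [set c]) by [].
under eq_integral do rewrite EFinM.
rewrite ge0_integralZl//; last by apply/measurable_EFinP; exact: measurable_indic.
under [RHS]eq_integral do rewrite EFinM -muleA.
rewrite ge0_integralZl//; last 2 first.
- by apply: emeasurable_funM; apply/measurable_EFinP => //; exact: measurable_indic.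
- by move=> x _; rewrite mule_ge0 ?lee_fin.
congr (_ * _)%E; rewrite integral_indic// setIT.
rewrite [LHS]integral_mkcond; apply: eq_integral => x _.
by rewrite /patch indicE; case: ifPn; rewrite ?mul1e ?mul0e.
Qed.

(** The formula holds for simple functions by the definition of the measure of their level sets, and
    passes to increasing limits. *)
Lemma ge0_integral_weighted (f : E -> \bar R) : measurable_fun setT f ->
  (forall x, (0 <= f x)%E) ->
  (\int[wm]_x f x = \int[m]_x (f x * (fine (h x) ^+ 2)%:E))%E.
Proof.
move=> mf f0; pose a := nnsfun_approx measurableT mf.
have af x : (a n x)%:E @[n --> \oo] --> f x by exact: cvg_nnsfun_approx.
have nda x : {homo (fun n => a n x) : p q / (p <= q)%N >-> p <= q}.
  by move=> p q pq; exact/lefP/nd_nnsfun_approx.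
have -> : (\int[wm]_x f x = limn (fun n => \int[wm]_x (a n x)%:E))%E.
  rewrite -monotone_convergence//.
  - by apply: eq_integral => x _; apply/esym/cvg_lim.
  - by move=> n; apply/measurable_EFinP.
  - by move=> n x _; rewrite lee_fin.
  - by move=> x _ p q pq; rewrite lee_fin nda.
under eq_fun do rewrite nnsfun_weighted.
rewrite -monotone_convergence//.
- by apply: eq_integral => x _; apply/cvg_lim => //; exact: cvgeZr.
- by move=> n; apply: emeasurable_funM; exact/measurable_EFinP.
- by move=> n x _; rewrite mule_ge0 ?lee_fin.
- by move=> x _ p q pq; rewrite lee_wpmul2r ?lee_fin// nda.
Qed.

Lemma ae_weighted (P : E -> Prop) : (\forall x \ae m, P x) -> \forall x \ae wm, P x.
Proof.
move=> [N [mN N0 PN]]; exists N; split => //.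
rewrite /weighted_measure; apply: null_set_integral => //.
by apply/measurable_EFinP; exact: measurable_funTS.
Qed.

End WeightedMeasure.

(** * Subcriticality and the transience of the transformed form *)

Section Subcritical.
Context {d : measure_display} {R : realType} {E : borelMetricType d R}.
Variables (m : {measure set E -> \bar R}) (F : qform E) (g : E -> R).
Hypothesis sf : Defs.symmetric_form m F.
Hypothesis g_weight : subcritical_weight m F g.

Let wg : weight m g. Proof. exact: g_weight.1. Qed.

(** An element of the domain lies in the extended space through the constant sequence. *)
Lemma subcritical_le v : dom F v ->
  (\int[m]_x (`|v x| * `|g x|)%:E <= (Num.sqrt (F v v))%:E)%E.
Proof.
move=> Dv; have mv := L2_measurable m v (dom_L2 m F sf v Dv).
have mg := weight_measurable m g wg; have [_ _ g0] := wg.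
have : extended_value m F (EFin \o v) (F v v).
  split; first exact/measurable_EFinP.
    by apply: aeW => x /=; rewrite ltry.
  exists (fun=> v); split => //.
  - move=> e e0; exists 0%N => n k _ _; rewrite subrr.
    by rewrite (psd0l (form_psd m F sf))//; exact: sf_dom0 sf.
  - by apply: aeW => x; exact: cvg_cst.
  - exact: cvg_cst.
move=> /(g_weight.2 _ _); apply: le_trans; rewrite le_eqVlt; apply/orP; left; apply/eqP.
apply: ae_eq_integral => //.
- by apply/measurable_EFinP; apply: measurable_funM; exact: measurableT_comp.
- apply: emeasurable_funM; last exact/measurable_EFinP.
  by do 2 apply: measurableT_comp => //; exact/measurable_EFinP.
- by apply: filterS g0 => x gx _; rewrite EFinM (gtr0_norm gx).
Qed.

Lemma transient_h_transform (h : {mfun E >-> \bar R}) :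
  transient (weighted_measure m h) (h_transform m F h).
Proof.
have mg := weight_measurable m g wg; have [ig [C gC] g0] := wg.
(* [|g| / h] need not be bounded nor [h^2 m]-integrable; the factor [exp (- 2 h)]
   makes the weight bounded by [|g|], [|g| / h] and [|g| / h^2] at once. *)
pose y x := expR (- `|fine (h x)|).
have y0 x : 0 < y x by exact: expR_gt0.
have hy x : `|fine (h x)| * y x <= 1.
  rewrite /y expRN ler_pdivrMr ?expR_gt0// mul1r.
  by apply: le_trans (expR_ge1Dx _); rewrite lerDr.
have y1 x : y x <= 1 by rewrite /y -expR0 ler_expR oppr_le0.
pose k x := `|g x| * y x ^+ 2.
have mh := measurable_fine_mfun h.
have mk : measurable_fun setT k.
  apply: measurable_funM; first exact: measurableT_comp.
  apply: measurable_funX; apply: measurableT_comp => //.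
  by do 2 apply: measurableT_comp => //.
have k0 x : 0 <= k x by rewrite mulr_ge0// sqr_ge0.
have hyy0 x : 0 <= `|fine (h x)| * y x by rewrite mulr_ge0// ltW.
(* This bound makes [k] integrable for [h^2 m]; [kh'] gives [int |u| k h^2 dm <= int |h u| |g| dm],
   to which subcriticality applies. *)
have kh x : k x * fine (h x) ^+ 2 <= `|g x|.
  rewrite /k -mulrA ler_piMr// -[fine _ ^+ 2]real_normK ?num_real// mulrC -exprMn.
  by rewrite exprn_ile1.
have kh' x : k x * fine (h x) ^+ 2 <= `|fine (h x)| * `|g x|.
  rewrite /k -[fine _ ^+ 2]real_normK ?num_real//.
  have -> : `|g x| * y x ^+ 2 * `|fine (h x)| ^+ 2 =
    (`|fine (h x)| * `|g x|) * ((`|fine (h x)| * y x) * y x) by ring.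
  by rewrite ler_piMr ?mulr_ge0// mulr_ile1// ltW.
exists k; last first.
  move=> u [Lu Dhu]; set hu := fun x => fine (h x) * u x in Dhu *.
  have mu : measurable_fun setT u by move: Lu; rewrite inE => /andP[]; rewrite inE.
  rewrite ge0_integral_weighted//; first last.
  - by move=> x; rewrite lee_fin mulr_ge0.
  - by apply/measurable_EFinP; apply: measurable_funM => //; exact: measurableT_comp.
  apply: le_trans (subcritical_le hu Dhu); apply: ge0_le_integral => //.
  - by move=> x _; apply: mule_ge0; rewrite lee_fin; [rewrite mulr_ge0|exact: sqr_ge0].
  - apply: emeasurable_funM; apply/measurable_EFinP; last exact: measurable_funX.
    by apply: measurable_funM => //; exact: measurableT_comp.
  - apply/measurable_EFinP; apply: measurable_funM; apply: measurableT_comp => //.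
    exact: measurable_funM.
  - move=> x _; rewrite -EFinM lee_fin -mulrA.
    have -> : `|hu x| * `|g x| = `|u x| * (`|fine (h x)| * `|g x|) by rewrite /hu normrM; ring.
    exact: ler_wpM2l.
split.
- apply/integrableP; split; first exact/measurable_EFinP.
  rewrite ge0_integral_weighted//; last first.
    by do 2 apply: measurableT_comp => //; exact/measurable_EFinP.
  have /integrableP[_] := ig; apply: le_lt_trans; apply: ge0_le_integral => //.
  - by move=> x _; apply: mule_ge0; rewrite lee_fin//; exact: sqr_ge0.
  - apply: emeasurable_funM; last exact/measurable_EFinP/measurable_funX.
    by apply: measurableT_comp => //; exact/measurable_EFinP.
  - by apply: measurableT_comp => //; exact/measurable_EFinP.
  - by move=> x _; rewrite /= (ger0_norm (k0 x)) -EFinM lee_fin.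
- exists C => x; rewrite ger0_norm// /k; apply: le_trans (gC x).
  by rewrite ler_piMr// exprn_ile1// ltW.
- by apply: ae_weighted; apply: filterS g0 => x gx; rewrite /k mulr_gt0 ?exprn_gt0// gtr0_norm.
Qed.

End Subcritical.

(** * Excessiveness under the monotone extension of the semigroup *)

Section Excessive.
Context {d : measure_display} {R : realType} {E : borelMetricType d R}.
Variables (m : {measure set E -> \bar R}) (F : qform E) (T : R -> (E -> R) -> (E -> R)).
Hypothesis sgF : semigroup_of m F T.
Hypothesis T_nneg : forall t f, 0 < t -> L2nneg m f -> L2nneg m (T t f).
Variable h : E -> \bar R.
Hypothesis h0 : \forall x \ae m, (0 <= h x)%E.
Hypothesis sg_le : forall t f, 0 < t -> L2nneg m f ->
  (\forall x \ae m, ((f x)%:E <= h x)%E) -> \forall x \ae m, ((T t f x)%:E <= h x)%E.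

Lemma semigroup_ext_le t : 0 < t -> \forall x \ae m, (semigroup_ext m T t h x <= h x)%E.
Proof.
(* Without an approximating sequence [xget] returns the zero sequence, whose image under [T t] is
   zero almost everywhere, and [h >= 0] suffices. *)
move=> t0; rewrite /semigroup_ext; case: xgetP => [f _ [Lf f0 fh]|_]; last first.
  have L0 := psd_dom0 _ _ (inner_psd m).
  have := sgB m F T sgF t 0 0 t0 L0 L0; rewrite subrr.
  apply: filterS2 h0 => x hx /(_ Logic.I) T0x.
  rewrite (_ : (fun n => _) = (fun=> 0%E)); first by rewrite lim_cst.
  by apply/funext => n /=; rewrite T0x fctE subrr.
have nf n : L2nneg m (f n) by split; [exact: Lf|exact: f0].
have f_le n : \forall x \ae m, ((f n x)%:E <= h x)%E.
  apply: filterS fh => x [ndx fx]; rewrite -(cvg_lim _ fx)//.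
  apply: lime_ge; first exact: cvgP fx.
  by exists n => // k nk; rewrite lee_fin ndx.
have T_le : \forall x \ae m, forall n, ((T t (f n) x)%:E <= h x)%E.
  by apply: ae_foralln => n; exact: sg_le.
(* Positivity applied to the increments makes [T t (f n)] increase with [n], so that [limn] is a
   true limit and inherits the bound. *)
have T_nd : \forall x \ae m, forall n, T t (f n) x <= T t (f n.+1) x.
  apply: ae_foralln => n.
  have nfB : L2nneg m (f n.+1 - f n).
    split; first exact: (psd_domB (inner_psd m) _ _ (Lf _) (Lf _)).
    apply: filterS fh => x [ndx _]; rewrite -[(_ - _) x]/(f n.+1 x - f n x) subr_ge0.
    exact: ndx.
  have [_] := T_nneg t _ t0 nfB.
  apply: filterS2 (sgB m F T sgF t _ _ t0 (Lf n.+1) (Lf n)) => x /(_ Logic.I) ->.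
  by rewrite -[(_ - _) x]/(T t (f n.+1) x - T t (f n) x) subr_ge0.
apply: filterS2 T_le T_nd => x xle xnd; apply: lime_le; last exact: nearW.
by apply: ereal_nondecreasing_is_cvgn; apply/nondecreasing_seqP => n; rewrite lee_fin.
Qed.

End Excessive.

Theorem lemma2p11 (d : measure_display) (R : realType)
    (E : borelMetricType d R)
    (E_lc : locally_compact [set: E]) (E_sep : separable_space E)
    (m : {measure set E -> \bar R})
    (m_radon : radon_measure m) (m_supp : full_support m)
    (F : qform E)
    (F_dirichlet : dirichlet_form m F) (F_regular : regular_form m F)
    (F_irreducible : irreducible m F) (F_transient : transient m F)
    (mu : {measure set E -> \bar R})
    (mu_radon : radon_measure mu) (mu_smooth : smooth_measure m F mu)
    (S_psd : positive_semidefinite (schroedinger_form F mu))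
    (S_closable : closable m (schroedinger_form F mu))
    (Fmu : qform E) (Fmu_closure : closure_of m (schroedinger_form F mu) Fmu)
    (Fmu_subcritical : subcritical m Fmu)
    (g : E -> R) (g_weight : subcritical_weight m Fmu g)
    (Tmu : R -> (E -> R) -> (E -> R)) (Tmu_semigroup : semigroup_of m Fmu Tmu)
    (Gg : {mfun E >-> \bar R}) (Gg_potential : potential_of m Tmu g Gg) :
  Hplus m Tmu Gg /\
  transient (weighted_measure m Gg) (h_transform m Fmu Gg).
Proof.
have [sf cl _ _ _] := Fmu_closure; have wg := g_weight.1.
split; last exact: (transient_h_transform m Fmu g sf g_weight Gg).
have T_nneg := sg_nneg m mu F Fmu F_dirichlet Fmu_closure Tmu Tmu_semigroup.
have ng := weight_nneg m g wg; have Lg := ng.1.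
have m_sf := weight_sigma_finite m g wg.
have [q qG] := potential_density_exists m Tmu g m_sf Gg Gg_potential
  (fun t t0 => (T_nneg t g t0 ng).2).
have GH := pd_integral _ _ _ _ _ qG.
have ipsd := inner_psd m.
(* As [is_resolvent] describes [a G_a], the datum [a^-1 *: g] yields [v = G_a g]. *)
have g_resolvent (a : R) v : 0 < a -> is_resolvent m Fmu a (a^-1 *: g) v ->
    inner m g v <= 1 /\ forall t : R, 0 < t -> 0 <= inner m (Tmu t g) v.
  move=> a0 rv; have nag : L2nneg m (a^-1 *: g).
    split; first exact: (psd_domZ ipsd).
    apply: filterS ng.2 => x gx; rewrite -[(_ *: _) x]/(a^-1 * g x) mulr_ge0//.
    by rewrite invr_ge0 ltW.
  have nv := resolvent_nneg m mu F Fmu F_dirichlet Fmu_closure a _ v a0 nag rv.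
  split; last by move=> t t0; apply: inner_ge0 => //; exact: T_nneg.
  have [Dv Fv] := rv; have Lv := nv.1.
  have Fvv : Fmu v v <= inner m g v.
    have Lag := nag.1.
    rewrite Fv// (psdBl ipsd)// (psdZl ipsd)// mulrBr mulrA divff ?gt_eqF// mul1r.
    by rewrite gerDl oppr_le0 mulr_ge0 ?(ltW a0)// (psd_ge0 _ _ ipsd).
  have gv : inner m g v <= Num.sqrt (Fmu v v).
    rewrite -lee_fin; apply: le_trans (subcritical_le m Fmu g sf g_weight v Dv).
    rewrite inner_EFin// le_eqVlt; apply/orP; left; apply/eqP.
    have mv := L2_measurable m v Lv; have mg := L2_measurable m g Lg.
    apply: ae_eq_integral => //.
    - by apply/measurable_EFinP; exact: measurable_funM.
    - by apply/measurable_EFinP; apply: measurable_funM; exact: measurableT_comp.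
    - by apply: filterS2 nv.2 ng.2 => x v0 g0 _; rewrite !ger0_norm// mulrC.
  (* With [s] the square root of [Fmu v v], the bounds read [s ^+ 2 <= (g, v) <= s]; hence [s <= 1],
     and so [(g, v) <= 1]. *)
  have := sqr_sqrtr (sf_ge0 sf Dv); have := sqrtr_ge0 (Fmu v v).
  by move: gv Fvv; set s := Num.sqrt _; nra.
have H_lty := potential_version_lty m Fmu Tmu g q Gg sf cl Tmu_semigroup wg qG g_resolvent.
have H_gt0 := potential_version_gt0 m Fmu Tmu g q Gg Tmu_semigroup wg qG.
split.
- exact: measurable_funP.
- by apply: filterS3 GH H_lty H_gt0 => x -> -> ->.
- apply: (semigroup_ext_le m Fmu Tmu Tmu_semigroup T_nneg).
    by apply: filterS2 GH H_gt0 => x -> /ltW.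
  move=> t f t0 nf fG.
  have fH : \forall x \ae m, ((f x)%:E <= potential_version q x)%E.
    by apply: filterS2 GH fG => x ->.
  have := sg_le_potential m Fmu Tmu g q Gg Tmu_semigroup T_nneg wg qG f t t0 nf fH.
  by apply: filterS2 GH => x ->.
Qed.
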